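(* Let $x,y,n,u,d,u',d'$ be nonnegative integers with $u,d\le n$, and let $U=\{s_1<\dots<s_u\}$, $D=\{t_1<\dots<t_d\}$, $U'=\{s'_1<\dots<s'_{u'}\}$, $D'=\{t'_1<\dots<t'_{d'}\}$ and $B=\{k_1<\dots<k_b\}$ be subsets of $[x+y+n]$ such that $|U\cup D|=n$, $U\cup D=U'\cup D'$, $U\cap D=U'\cap D'$, $B\cap(U\cup D)=\emptyset$ and $|B|\le x$. Then $$\frac{\operatorname{M}(H_{x,y}(U;D;B))}{\operatorname{M}(H_{x,y}(U';D';B))}=\frac{\displaystyle\prod_{1\le i<j\le u}\frac{s_j-s_i}{j-i}\ \prod_{1\le i<j\le d}\frac{t_j-t_i}{j-i}\ \operatorname{PP}(u,d,y)}{\displaystyle\prod_{1\le i<j\le u'}\frac{s'_j-s'_i}{j-i}\ \prod_{1\le i<j\le d'}\frac{t'_j-t'_i}{j-i}\ \operatorname{PP}(u',d',y)}.$$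
   Context: Notation: $[m]=\{1,2,\dots,m\}$, and for nonnegative integers $a,b,c$, $$\operatorname{PP}(a,b,c)=\prod_{i=1}^{a}\prod_{j=1}^{b}\prod_{k=1}^{c}\frac{i+j+k-1}{i+j+k-2}.$$ Work on the triangular lattice of the plane with unit-side equilateral triangles, drawn so that one family of lattice lines is horizontal. Each unit triangle is up-pointing (horizontal edge at the bottom) or down-pointing (horizontal edge at the top). A lozenge is the union of two unit triangles sharing an edge. A (lozenge) tiling of a region (a finite union of unit triangles) is a covering of the region by lozenges contained in it, with no gaps and no overlaps. Definition of $H_{x,y}(U;D;B)$: let $U,D\subseteq[x+y+n]$ (not necessarily disjoint) with $|U|=u$, $|D|=d$, $|U\cup D|=n$, and let $B\subseteq[x+y+n]\setminus(U\cup D)$. Consider the lattice hexagon with all angles $120^\circ$ and side lengths $x+n-u,\ y+u,\ y+d,\ x+n-d,\ y+d,\ y+u$ in clockwise order starting from the (horizontal) north side; sides of length $0$ are allowed. Let $l$ be the horizontal lattice line through the west and east vertices of the hexagon; its part inside the hexagon has length $x+y+n$ and consists of unit segments labelled $1,2,\dots,x+y+n$ from left to right. The up-pointing unit triangle at position $i$ is the one lying just above $l$ whose bottom edge is the $i$-th segment; the down-pointing unit triangle at position $i$ is the one lying just below $l$ whose top edge is the $i$-th segment. Remove from the hexagon the up-pointing unit triangles at the positions in $U$ and the down-pointing unit triangles at the positions in $D$, and place a barrier on the $i$-th segment of $l$ for every $i\in B$. The resulting region with barriers is $H_{x,y}(U;D;B)$. A tiling of $H_{x,y}(U;D;B)$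 is a lozenge tiling of the region containing, for every $i\in B$, no vertical lozenge at position $i$, i.e. not containing the lozenge formed by the two unit triangles sharing the $i$-th segment of $l$. $\operatorname{M}(H_{x,y}(U;D;B))$ is the number of such tilings. The region $H_{x,y}(U';D';B)$ is defined in the same way with $U',D',u',d'$ in place of $U,D,u,d$ (with the same $x,y,n$). *)

(* Defs.v *)
From mathcomp Require Import all_boot all_order all_algebra finmap.

Set Implicit Arguments.
Unset Strict Implicit.
Unset Printing Implicit Defensive.

Import Order.TTheory GRing.Theory Num.Theory.
Local Open Scope fset_scope.
Local Open Scope ring_scope.

(* (a, b) stands for the lattice point a * (1, 0) + b * (1/2, sqrt 3 / 2); the
   second coordinate is the height of the horizontal lattice line through it. *)
Notation point := (int * int)%type.

(* A unit triangle is given by the left end p of its horizontal edge (which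
   joins p and p + (1, 0)) and by its orientation, true meaning up-pointing. *)
Notation triangle := (point * bool)%type.

Definition vertices (t : triangle) : {fset point} :=
  let: ((a, b), up) := t in
  [fset (a, b); (a + 1, b); if up then (a, b + 1) else (a + 1, b - 1)].

Definition share_edge (s t : triangle) : bool :=
  #|` vertices s `&` vertices t| == 2%N.

Definition is_lozenge (L : {fset triangle}) : bool :=
  [exists s : L, exists t : L,
     share_edge (val s) (val t) && (L == [fset val s; val t])].

Definition is_tiling (R : {fset triangle}) (T : {fset {fset triangle}}) : bool :=
  [&& [forall L : T, is_lozenge (val L)], trivIfset T & fcover T == R].

Definition tilings (R : {fset triangle}) : {fset {fset {fset triangle}}} :=
  [fset T in fpowerset (fpowerset R) | is_tiling R T].

(* The hexagon with angles 120 degrees and sides north, h, k, south, k, h,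
   clockwise from the north side, where north + h = south + k. Its corners,
   clockwise from the west one, are (0, 0), (0, h), (north, h), (north + h, 0),
   (south + k, - k), (k, - k); the inequalities are the six half-planes bounded
   by its sides. *)
Definition in_hexagon (north south h k : nat) (p : point) : bool :=
  [&& 0 <= p.1, p.2 <= h%:Z, p.1 + p.2 <= (north + h)%:Z,
      p.1 <= (south + k)%:Z, - k%:Z <= p.2 & 0 <= p.1 + p.2].

Definition hexagon_points (north south h k : nat) : {fset point} :=
  [fset p in [fset (i%:Z, j%:Z - k%:Z) | i in iota 0%N (south + k).+1%N,
                                         j in iota 0%N (h + k).+1%N]
     | in_hexagon north south h k p].

Lemma mem_hexagon_points (north south h k : nat) (p : point) :
  (p \in hexagon_points north south h k) = in_hexagon north south h k p.
Proof.
rewrite !inE /=; apply/andP/idP => [[] // | hp]; split => //.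
case: p hp => a b /and5P[/= a0 bh _ aS /andP[kb _]].
have bk0 : 0 <= b + k%:Z by rewrite -lerBlDr sub0r.
have aP : absz a \in iota 0%N (south + k).+1%N.
  by rewrite mem_iota leq0n add0n ltnS -lez_nat gez0_abs.
have bP : absz (b + k%:Z) \in iota 0%N (h + k).+1%N.
  by rewrite mem_iota leq0n add0n ltnS -lez_nat gez0_abs // PoszD lerD2r.
apply/imfset2P; exists (absz a) => //; exists (absz (b + k%:Z)) => //.
by rewrite !gez0_abs // addrK.
Qed.

Definition hexagon (north south h k : nat) : {fset triangle} :=
  [fset t in hexagon_points north south h k `*` [fset true; false]
     | vertices t `<=` hexagon_points north south h k].

(* The horizontal line through the west and east corners is the one at height
   0. Positions are numbered from 0, so i : 'I_(x + y + n) is the segment from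
   (i, 0) to (i + 1, 0), which has label i + 1 when labels start from 1. *)
Definition up_at (i : nat) : triangle := ((i%:Z, 0), true).
Definition down_at (i : nat) : triangle := ((i%:Z, 0), false).
Definition vertical_lozenge (i : nat) : {fset triangle} :=
  [fset up_at i; down_at i].

Section Region.
Variables (x y n : nat) (U D B : {set 'I_(x + y + n)%N}).

Definition H_region : {fset triangle} :=
  hexagon (x + n - #|U|)%N (x + n - #|D|)%N (y + #|U|)%N (y + #|D|)%N
    `\` [fset up_at (val i) | i in U] `\` [fset down_at (val i) | i in D].

Definition H_tilings : {fset {fset {fset triangle}}} :=
  [fset T in tilings H_region | [forall i in B, vertical_lozenge i \notin T]].

Definition M_H : nat := #|` H_tilings|.

End Region.

Definition PP (a b c : nat) : rat :=
  \prod_(1 <= i < a.+1) \prod_(1 <= j < b.+1) \prod_(1 <= k < c.+1)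
    (((i + j + k)%:R - 1) / ((i + j + k)%:R - 2)).

(* Indices run from 0; this leaves the differences j - i unchanged. *)
Definition diff_prod (r m : nat) (s : 'I_r -> 'I_m) : rat :=
  \prod_(i < r) \prod_(j < r | (i < j)%N)
    (((s j)%:R - (s i)%:R) / (j%:R - i%:R)).

(* Main.v *)
Require Import Defs.
From mathcomp Require Import all_boot all_order all_algebra finmap.
From mathcomp Require Import zify ring.

(** Cut the hexagon along the horizontal line l.  A tiling is determined by the
    set V of positions of its vertical lozenges on l, a tiling of the upper half
    with the triangles of U and V missing along l, and a tiling of the lower half
    with those of D and V missing.  Each half is a trapezoid with unit dents along
    its long side, and the number of tilings of such a trapezoid with dents at
    p_1 < ... < p_h, h being its height, is the product of the
    (p_j - p_i) / (j - i) (the formula of Cohn, Larsen and Propp); for any other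
    number of dents it is 0.  Hence V always has y elements and

      M(H) = const(u, d) * sum over V of Delta(U + V) * Delta(D + V),

    where Delta(S) is the product of the differences of the elements of S, the
    constant is 1 / (sf(y + u) * sf(y + d)), and sf(m) = 0! 1! ... (m - 1)!.  For
    V disjoint from U, Delta(U + V) is Delta(U) * Delta(V) times the product of the
    distances |w - v| for w in U and v in V.  In Delta(U + V) * Delta(D + V) each v
    thus meets every point of U once and every point of D once, that is every point
    of U :|: D once and every point of U :&: D once more.  So Delta(U) * Delta(D)
    factors out of the sum, and what is left depends only on U :|: D, U :&: D and
    B: it is common to both regions and cancels.  It is nonzero because the
    condition on #|B| leaves room for y elements outside U, D and B.  The remaining
    constants agree with the right-hand side since PP(u, d, y) is a quotient of
    superfactorials in which sf(y), sf(u + d) and sf(u + d + y) depend only on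
    u + d, and u + d = u' + d'.

    Tilings are treated as perfect matchings of the adjacency graph of the unit
    triangles, and every fact about them comes from one recursion, the expansion
    at a vertex ([nmatch_expand]).  It gives the cutting formula ([nmatch_cut]) by
    induction on one of the two sides, and it removes the bottom row of a trapezoid
    cell by cell ([nmatch_peel]), which turns the count of tilings into the count of
    Gelfand-Tsetlin patterns ([dented_patterns]).  The product formula follows
    by writing the product as a determinant of binomial coefficients and summing
    over interlacing sequences by multilinearity ([patterns_det]). *)

Set Implicit Arguments.
Unset Strict Implicit.
Unset Printing Implicit Defensive.

Local Open Scope fset_scope.

(** * Perfect matchings and expansion at a vertex *)

Section Matchings.
Variable K : choiceType.
Implicit Types (e : rel K) (A C R L : {fset K}) (T : {fset {fset K}}) (v w : K).

(** For [e := share_edge] these definitions unfold to [is_lozenge], [is_tiling] and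
    [tilings].  The relation is a parameter because barriers are encoded by deleting
    edges, and because the halves of the hexagon are moved to another graph. *)
Definition is_edge e L :=
  [exists s : L, exists t : L, e (val s) (val t) && (L == [fset val s; val t])].

Definition is_matching e R T :=
  [&& [forall L : T, is_edge e (val L)], trivIfset T & fcover T == R].

Definition matchings e R : {fset {fset {fset K}}} :=
  [fset T in fpowerset (fpowerset R) | is_matching e R T].

Definition nmatch e R := #|` matchings e R|.

Lemma is_edgeP e L :
  reflect (exists v w, e v w /\ L = [fset v; w]) (is_edge e L).
Proof.
apply: (iffP existsP) => [[s /existsP[t /andP[est /eqP ->]]]|].
  by exists (val s), (val t).
move=> [v [w [evw ->]]].
have vL : v \in [fset v; w] by rewrite !inE eqxx.
have wL : w \in [fset v; w] by rewrite !inE eqxx orbT.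
by exists [` vL]; apply/existsP; exists [` wL]; rewrite /= evw eqxx.
Qed.

Lemma mem_fcover T v :
  reflect (exists2 L, L \in T & v \in L) (v \in fcover T).
Proof.
rewrite /fcover; apply: (iffP (bigfcupP _ _ _ _)) => [[L]|[L LT vL]].
  by rewrite andbT => LT vL; exists L.
by exists L; rewrite ?LT.
Qed.

Lemma matchingsP e R T :
  reflect [/\ {in T, forall L, is_edge e L},
              {in T &, forall A B, A != B -> [disjoint A & B]}
            & fcover T = R]
          (T \in matchings e R).
Proof.
rewrite !inE /= /is_matching; apply: (iffP idP).
  case/andP=> _ /and3P[/forallP edT /trivIfsetP trT /eqP cT]; split => // L LT.
  exact: (edT [` LT]).
case=> edT trT cT; apply/andP; split; last first.
  apply/and3P; split; [|exact/trivIfsetP|exact/eqP].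
  by apply/forallP => L; apply: edT; apply: valP.
rewrite fpowersetE; apply/fsubsetP => L LT; rewrite fpowersetE.
apply/fsubsetP => v vL.
by rewrite -cT; apply/mem_fcover; exists L.
Qed.

Lemma nmatch0 e : nmatch e fset0 = 1%N.
Proof.
rewrite /nmatch; suff -> : matchings e fset0 = [fset fset0] by rewrite cardfs1.
apply/fsetP => T; rewrite in_fset1; apply/idP/idP => [/matchingsP[edT _ cT]|/eqP->].
   rewrite -[_ == _]negbK; apply/negP => /fset0Pn[L LT].
  have [v [w [_ eL]]] := is_edgeP _ _ (edT L LT).
  suff : v \in fset0 by [].
  by rewrite -cT; apply/mem_fcover; exists L; rewrite // eL !inE eqxx.
apply/matchingsP; split=> //; apply/fsetP => v; rewrite inE; apply/negbTE/negP.
by case/mem_fcover.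
Qed.

Lemma eq_in_nmatch e e' R :
  {in R &, e =2 e'} -> nmatch e R = nmatch e' R.
Proof.
have sub e1 e2 : {in R &, e1 =2 e2} -> matchings e1 R `<=` matchings e2 R.
  move=> ee; apply/fsubsetP => T /matchingsP[edT trT cT]; apply/matchingsP.
  split=> // L LT; have [v [w [evw eL]]] := is_edgeP _ _ (edT L LT).
  have RL z : z \in L -> z \in R by move=> zL; rewrite -cT; apply/mem_fcover; exists L.
  by apply/is_edgeP; exists v, w; rewrite -ee ?RL // eL !inE eqxx ?orbT.
move=> ee; rewrite /nmatch.
suff -> : matchings e R = matchings e' R by [].
by apply/eqP; rewrite eqEfsubset !sub // => v w vR wR; rewrite ee.
Qed.

Section Expansion.
Variable e : rel K.
Hypotheses (e_sym : symmetric e) (e_irr : irreflexive e).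

(** Erasing the edge {v, w} from a matching that uses it leaves a matching of the
    other vertices, and putting it back is the inverse operation. *)
Lemma matchings_with v w R : v \in R -> w \in R -> e v w ->
  #|` [fset T in matchings e R | [fset v; w] \in T]|
    = nmatch e (R `\` [fset v; w]).
Proof.
move=> vR wR evw; set L := [fset v; w].
have vwR : L `<=` R by rewrite fsubUset !fsub1set vR.
have LN T : T \in matchings e (R `\` L) -> L \notin T.
  case/matchingsP=> _ _ cT; apply/negP => LT.
  have : v \in R `\` L by rewrite -cT; apply/mem_fcover; exists L; rewrite // !inE eqxx.
  by rewrite !inE eqxx.
rewrite /nmatch.
have -> : [fset T in matchings e R | L \in T]
     = [fset (L |` T) | T in matchings e (R `\` L)].
  apply/fsetP => T; rewrite in_fset inE /=; apply/idP/imfsetP => /=.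
    case/andP=> /matchingsP[edT trT cT] LT.
    exists (T `\ L); last by rewrite fsetD1K.
    apply/matchingsP; split.
    - by move=> A; rewrite in_fsetD1 => /andP[_]; apply: edT.
    - by move=> A B; rewrite !in_fsetD1 => /andP[_ AT] /andP[_ BT]; apply: trT.
    apply/fsetP => z; rewrite in_fsetD -cT; apply/mem_fcover/andP.
      case=> A; rewrite in_fsetD1 => /andP[AL AT] zA; split; last first.
        by apply/mem_fcover; exists A.
      by move/fdisjointP: (trT A L AT LT AL) => /(_ z zA).
    case=> zL /mem_fcover[A AT zA]; exists A => //; rewrite in_fsetD1 AT andbT.
    by apply: contraNneq zL => <-.
  move=> [T' T'M ->]; rewrite fset1U1 andbT.
  have LT' := LN _ T'M.
  move: T'M => /matchingsP[edT trT cT]; apply/matchingsP; split.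
  - move=> A; rewrite in_fset1U => /orP[/eqP->|]; last exact: edT.
    by apply/is_edgeP; exists v, w.
  - have dL A : A \in T' -> [disjoint L & A].
      move=> AT; rewrite fdisjoint_sym; apply/fdisjointP => z zA.
      have : z \in R `\` L by rewrite -cT; apply/mem_fcover; exists A.
      by rewrite in_fsetD => /andP[].
    move=> A B; rewrite !in_fset1U => /orP[/eqP->|AT] /orP[/eqP->|BT].
    + by rewrite eqxx.
    + by move=> _; apply: dL.
    + by move=> _; rewrite fdisjoint_sym; apply: dL.
    + exact: trT.
  apply/fsetP => z; apply/mem_fcover/idP.
    case=> A; rewrite in_fset1U => /orP[/eqP->|AT] zA.
      by apply: (fsubsetP vwR).
    have : z \in R `\` L by rewrite -cT; apply/mem_fcover; exists A.
    by rewrite in_fsetD => /andP[].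
  move=> zR; have [zL|zL] := boolP (z \in L); first by exists L; rewrite ?fset1U1.
  have : z \in fcover T' by rewrite cT in_fsetD zL.
  by case/mem_fcover=> A AT zA; exists A; rewrite // in_fset1U AT orbT.
rewrite card_in_imfset //= => T1 T2 /LN L1 /LN L2 eqT.
by rewrite -(fsetU1K L1) eqT fsetU1K.
Qed.

(** In each matching, v is covered by exactly one edge; the matchings are sorted
    according to the other end w of that edge. *)
Lemma nmatch_expand v R : v \in R ->
  nmatch e R = (\sum_(w <- R | e v w) nmatch e (R `\` [fset v; w]))%N.
Proof.
move=> vR; rewrite [LHS]card_fset_sum1.
transitivity (\sum_(T <- matchings e R) \sum_(w <- R | e v w)
                 ([fset v; w] \in T : nat))%N.
  rewrite [LHS]big_seq [RHS]big_seq; apply: eq_bigr => T /matchingsP[edT trT cT].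
  have : v \in fcover T by rewrite cT.
  case/mem_fcover=> L LT vL.
  have [w evw eL] : exists2 w, e v w & L = [fset v; w].
    have [a [b [eab eL]]] := is_edgeP _ _ (edT L LT).
    move: vL; rewrite eL !inE => /orP[]/eqP ->; first by exists b.
    by exists a; rewrite 1?e_sym // fsetUC.
  have wR : w \in R by rewrite -cT; apply/mem_fcover; exists L; rewrite // eL !inE eqxx orbT.
  rewrite big_mkcond (big_fsetD1 w) //= evw -eL LT big1_seq //= => z.
  rewrite in_fsetD1 => /andP[zw zR]; case: ifP => // evz.
  case zT: (_ \in T) => //.
  have zL : z \notin L.
    rewrite eL !inE negb_or zw andbT; apply: contraTneq evz => ->.
    by rewrite e_irr.
  have : [fset v; z] != L by apply: contraNneq zL => <-; rewrite !inE eqxx orbT.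
  move=> /(trT _ _ zT LT)/fdisjointP/(_ v); rewrite !inE eqxx vL.
  by move=> /(_ isT).
rewrite exchange_big /= big_seq_cond [RHS]big_seq_cond; apply: eq_bigr => w /andP[wR evw].
rewrite -matchings_with // card_fset_sum1.
rewrite [RHS]big_fset /= [RHS]big_mkcond /=.
by apply: eq_bigr => T _; case: ifP.
Qed.

End Expansion.
End Matchings.

(** * Cutting a graph into two parts *)

Section Cut.
Variables (K : choiceType) (I : finType) (e : rel K) (a c : I -> K).
Hypotheses (e_sym : symmetric e) (e_irr : irreflexive e).
Hypotheses (a_inj : injective a) (c_inj : injective c).
Implicit Types (A C : {fset K}) (S V : {set I}).

Definition crossing S A C V := [forall i in V, [&& i \in S, a i \in A & c i \in C]].

Lemma mem_image_fset (f : I -> K) V v :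
  reflect (exists2 i, i \in V & v = f i) (v \in [fset f i | i in V]).
Proof. exact: imfsetP. Qed.

(** A matching is determined by the set V of the cross edges {a i, c i} that it uses,
    together with what it does on each side.  The proof avoids splitting matchings:
    by induction on A, both sides of the formula satisfy the same expansion at a
    vertex v of A.  The partners of v in A give the terms in which no cross edge at v
    is used, and the partner c i of v = a i in C gives those with i in V. *)
Lemma nmatch_cut S A C :
    [disjoint A & C] ->
    (forall v w, v \in A -> w \in C ->
       e v w = [exists i in S, (v == a i) && (w == c i)]) ->
  nmatch e (A `|` C)
    = (\sum_(V | crossing S A C V)
         nmatch e (A `\` [fset a i | i in V]) *
         nmatch e (C `\` [fset c i | i in V]))%N.
Proof.
have [m] := ubnP #|` A|; elim: m A C => // m IH A C leA dAC eAC.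
have [->|[v vA]] := fset_0Vmem A.
  rewrite fset0U (big_pred1 set0) => [|V].
    have img0 (f : I -> K) : [fset f i | i in (set0 : {set I})] = fset0.
      by apply/fsetP => z; rewrite [RHS]inE; apply/negP => /mem_image_fset[i]; rewrite inE.
    by rewrite !img0 !fsetD0 nmatch0 mul1n.
  rewrite /= -subset0; apply/forall_inP/subsetP => sV i iV; have := sV i iV.
    by rewrite inE andbF.
  by rewrite in_set0.
have vC : v \notin C by move/fdisjointP: dAC; apply.
rewrite (nmatch_expand e_sym e_irr (v := v)); last by rewrite inE vA.
rewrite (bigID (fun w => w \in A)) /=.
have cardD (A' B : {fset K}) v' : v' \in A' -> v' \in B -> (#|` A'| < m.+1)%N -> (#|` A' `\` B| < m)%N.
  move=> vA' vB lt; apply: leq_trans (_ : #|` A'| <= m)%N => //.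
  rewrite (cardfsD1 v' A') vA' ltnS; apply/fsubset_leq_card/fsubsetP => z.
  by rewrite !inE => /andP[zB ->]; rewrite andbT; apply: contraNneq zB => ->.
have imP V i : reflect (i \in V) (a i \in [fset a i | i in V]).
  by apply: (iffP (mem_image_fset _ _ _)) => [[j jV /a_inj->]|iV] //; exists i.
have crossA w V : crossing S (A `\` [fset v; w]) C V =
   [&& crossing S A C V, v \notin [fset a i | i in V] & w \notin [fset a i | i in V]].
  apply/forall_inP/and3P => [H|[/forall_inP H vV wV] i iV].
    split; first by apply/forall_inP => i /H; rewrite !inE => /and3P[-> /andP[_ ->] ->].
      by apply/mem_image_fset => -[i /H + vi]; rewrite !inE -vi eqxx andbF.
    by apply/mem_image_fset => -[i /H + wi]; rewrite !inE -wi eqxx orbT andbF.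
  have /and3P[-> aA ->] := H i iV; rewrite !inE aA !andbT /= negb_or.
  by apply/andP; split; [move: vV|move: wV]; apply: contraNneq => <-; apply/imP.
rewrite [RHS](bigID (fun V => v \notin [fset a i | i in V])) /=; congr (_ + _)%N.
  (* the partner w of v lies in A *)
  transitivity (\sum_(w <- A | e v w) \sum_(V | crossing S (A `\` [fset v; w]) C V)
     nmatch e (A `\` [fset v; w] `\` [fset a i | i in V]) *
     nmatch e (C `\` [fset c i | i in V]))%N.
    transitivity (\sum_(w <- A | e v w) nmatch e ((A `|` C) `\` [fset v; w]))%N.
      apply: eq_fbig_cond => // w; rewrite !inE /=; case: (w \in A); rewrite ?andbT ?andbF //=.
    rewrite big_seq_cond [RHS]big_seq_cond; apply: eq_bigr => w /andP[wA evw].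
    rewrite -IH.
    - suff -> : (A `|` C) `\` [fset v; w] = (A `\` [fset v; w]) `|` C by [].
      apply/fsetP => z; rewrite !inE; case zC: (z \in C); rewrite ?orbF // !orbT andbT.
      rewrite negb_or; apply/andP; split; apply: contraTneq zC => -> //.
      by move/fdisjointP: dAC; apply.
    - by apply: (cardD _ _ v) leA; rewrite // !inE eqxx.
    - apply/fdisjointP => z; rewrite !inE => /andP[_ zA].
      by move/fdisjointP: dAC; apply.
    by move=> v' w'; rewrite inE => /andP[_ v'A] w'C; apply: eAC.
  rewrite (exchange_big_dep xpredT) //= [RHS]big_mkcond /=; apply: eq_bigr => V _.
  case: ifP => [/andP[cV vV]|nV]; last first.
    rewrite big1 // => w; rewrite crossA => /and4P[_ cV vV _].
    by rewrite cV vV in nV.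
  rewrite -big_distrl /= [in RHS](nmatch_expand e_sym e_irr (v := v)); last by rewrite inE vV.
  congr (_ * _)%N; apply: eq_fbig_cond => w.
    by rewrite !inE /= crossA cV vV /=; case: (w \in A); rewrite ?andbF ?andbT //= andbC.
  move=> _ _; suff -> : A `\` [fset v; w] `\` [fset a i | i in V]
      = A `\` [fset a i | i in V] `\` [fset v; w] by [].
  by rewrite !fsetDDl fsetUC.
(* the partner of v lies in C; it can only be the c i with a i = v *)
have [i /and3P[iS /eqP ai ci]|no] := pickP (fun i => [&& i \in S, a i == v & c i \in C]); last first.
  rewrite big_seq_cond big1 => [|w]; last first.
    rewrite inE => /and3P[wAC evw wA]; move: wAC; rewrite (negbTE wA) /= => wC.
    move: evw; rewrite eAC // => /existsP[i /and3P[iS /eqP vi /eqP wi]].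
    by have := no i; rewrite iS -vi -wi eqxx wC.
  rewrite big_pred0 // => V; apply/negP => /andP[/forall_inP cV].
  rewrite negbK => /mem_image_fset[i iV vi].
  by have := no i; have /and3P[-> _ ->] := cV i iV; rewrite vi eqxx.
have iA : c i \notin A by apply: contraTN ci; move/fdisjointP: dAC; apply.
rewrite big_mkcond (big_fsetD1 (c i)) /=; last by rewrite inE ci orbT.
have evi : e v (c i) by rewrite eAC //; apply/existsP; exists i; rewrite iS ai !eqxx.
rewrite evi iA /= big1_seq ?addn0 => [|w /=]; last first.
  rewrite !inE => /andP[wci wAC]; case: ifP => // /andP[evw wA].
  move: wAC evw; rewrite (negbTE wA) /= => wC; rewrite eAC // => /existsP[j /and3P[_ /eqP vj /eqP wj]].
  by case/eqP: wci; rewrite wj; congr c; apply: a_inj; rewrite ai.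
have -> : (A `|` C) `\` [fset v; c i] = (A `\` [fset v]) `|` (C `\` [fset c i]).
  apply/fsetP => z; rewrite !inE negb_or.
  case: (eqVneq z v) => [->|_] /=; first by rewrite (negbTE vC) andbF.
  by case: (eqVneq z (c i)) => [->|_] /=; rewrite ?(negbTE iA).
rewrite IH; last 3 first.
- by apply: (cardD _ _ v) leA; rewrite // !inE eqxx.
- apply/fdisjointP => z; rewrite !inE => /andP[_ zA].
  by rewrite (negbTE (fdisjointP dAC z zA)) andbF.
- by move=> v' w'; rewrite !inE => /andP[_ v'A] /andP[_ w'C]; apply: eAC.
rewrite [RHS](reindex_onto (fun V => i |: V) (fun V => V :\ i)) /=; last first.
  by move=> V /andP[_]; rewrite negbK -ai => /imP iV; rewrite finset.setD1K.
have Vi V : ((i |: V) :\ i == V) = (i \notin V).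
  apply/eqP/idP => [<-|]; first by rewrite !inE eqxx.
  exact: finset.setU1K.
have imU (f : I -> K) V : [fset f j | j in (i |: V)%SET] = f i |` [fset f j | j in V].
  apply/fsetP => z; rewrite in_fset1U; apply/mem_image_fset/orP.
    by case=> j /setU1P[->|jV] ->; rewrite ?eqxx; [left|right; apply/mem_image_fset; exists j].
  case=> [/eqP->|/mem_image_fset[j jV ->]]; first by exists i; rewrite ?setU11.
  by exists j; rewrite ?setU1r.
apply: eq_big => V; last by move=> _; rewrite !imU !fsetDDl ai.
rewrite Vi negbK -ai imU fset1U1 andbT.
apply/forall_inP/andP => [H|[/forall_inP H iV] j jV].
  split; last by apply/negP => /H; rewrite !inE eqxx andbF.
  apply/forall_inP => j /setU1P[->|/H]; first by rewrite iS ai vA ci.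
  by rewrite !inE => /and3P[-> /andP[_ ->] /andP[_ ->]].
have /and3P[-> aA cC] := H j (setU1r i jV).
by rewrite !inE aA cC !inj_eq // !andbT andbb; apply: contraNneq iV => <-.
Qed.
End Cut.

(** Both sides obey the same recursion, the expansion at a vertex and at its image. *)
Lemma nmatch_imfset (K K' : choiceType) (f : K' -> K) (e : rel K) (R : {fset K'}) :
    symmetric e -> irreflexive e -> injective f ->
  nmatch e [fset f v | v in R] = nmatch (relpre f e) R.
Proof.
move=> e_sym e_irr f_inj; have [m] := ubnP #|` R|; elim: m R => // m IH R leR.
have [->|[v vR]] := fset_0Vmem R.
  by rewrite imfset0 !nmatch0.
rewrite (nmatch_expand e_sym e_irr (v := f v)); last by rewrite mem_imfset.
have fe_sym : symmetric (relpre f e) by move=> w w' /=; rewrite e_sym.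
have fe_irr : irreflexive (relpre f e) by move=> w /=; rewrite e_irr.
rewrite [RHS](nmatch_expand fe_sym fe_irr vR).
rewrite big_mkcond big_imfset /=; last by move=> ? ? _ _; apply: f_inj.
rewrite -big_mkcond /=.
rewrite big_seq_cond [RHS]big_seq_cond; apply: eq_bigr => w /andP[wR _].
rewrite -IH; last first.
  apply: leq_trans (_ : #|` R| <= m)%N => //; rewrite [X in (_ < X)%N](cardfsD1 v) vR ltnS.
  apply/fsubset_leq_card/fsubsetP => z.
  by rewrite !inE => /andP[+ ->]; rewrite negb_or andbT => /andP[].
suff -> : [fset f v | v in R] `\` [fset f v; f w] = [fset f v | v in R `\` [fset v; w]] by [].
apply/fsetP => z; rewrite !inE; apply/andP/imfsetP => /=.
  case=> zN /imfsetP[z' /= z'R ez]; move: zN; rewrite ez !inj_eq // => z'N.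
  by exists z'; rewrite // !inE z'N.
case=> z'; rewrite !inE => /andP[z'N z'R] ->; rewrite !inj_eq // z'N.
by rewrite mem_imfset.
Qed.

(** * Tilings of a dented trapezoid *)

Section Forced.
Variables (K : choiceType) (e : rel K).
Hypotheses (e_sym : symmetric e) (e_irr : irreflexive e).

Lemma nmatch_expand1 (R : {fset K}) v w1 :
    v \in R -> e v w1 -> (forall w, w \in R -> e v w -> w = w1) ->
  nmatch e R = (if w1 \in R then nmatch e (R `\` [fset v; w1]) else 0)%N.
Proof.
move=> vR ev1 only; rewrite (nmatch_expand e_sym e_irr vR).
case: ifP => w1R; last first.
  rewrite big_seq_cond big1 // => w /andP[wR evw].
  by rewrite -(only w wR evw) wR in w1R.
rewrite big_mkcond (big_fsetD1 w1) //= ev1 big1_seq ?addn0 // => w /=.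
rewrite in_fsetD1 => /andP[ww1 wR]; case: ifP => // evw.
by case/eqP: ww1; apply: only.
Qed.

Lemma nmatch_expand2 (R : {fset K}) v w1 w2 :
    v \in R -> e v w1 -> e v w2 -> w1 != w2 ->
    (forall w, w \in R -> e v w -> w = w1 \/ w = w2) ->
  nmatch e R = ((if w1 \in R then nmatch e (R `\` [fset v; w1]) else 0) +
                (if w2 \in R then nmatch e (R `\` [fset v; w2]) else 0))%N.
Proof.
move=> vR ev1 ev2 w12 only; rewrite (nmatch_expand e_sym e_irr vR).
have single (w0 : K) (F : K -> nat) : (\sum_(w <- R | w == w0) F w)%N = (if w0 \in R then F w0 else 0)%N.
  case: ifP => w0R; last first.
    by rewrite big_seq_cond big1 // => w /andP[wR /eqP ww]; rewrite -ww wR in w0R.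
  rewrite big_mkcond (big_fsetD1 w0) //= eqxx big1_seq ?addn0 // => w /=.
  by rewrite in_fsetD1 => /andP[/negbTE->].
pose F w := nmatch e (R `\` [fset v; w]).
rewrite -(single w1 F) -(single w2 F) (bigID (pred1 w1)) /=; congr (_ + _)%N.
  by apply: eq_bigl => w; case: eqP => [->|]; rewrite ?ev1 ?andbF.
rewrite big_seq_cond [RHS]big_seq_cond; apply: eq_bigl => w.
case wR: (w \in R) => //=; apply/andP/eqP => [[evw /eqP ww1]|->].
  by case: (only w wR evw).
by rewrite ev2 eq_sym.
Qed.
End Forced.

(** A cell ((a, b), o) is a unit triangle of a trapezoid, with coordinates counted
    from the left end of the long side of the trapezoid: its horizontal edge starts
    at (a, b), in the same oblique coordinates as points, and o tells whether the
    triangle lies on the side of that edge away from the long side. *)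
Notation cell := (nat * nat * bool)%type.

Definition up_down (a b a' b' : nat) :=
  [|| (a' == a) && (b' == b), (a' == a) && (b' == b.+1) | (a == a'.+1) && (b' == b.+1)].

Definition adj (s t : cell) : bool :=
  let: ((a, b), o) := s in let: ((a', b'), o') := t in
  if o then ~~ o' && up_down a b a' b' else o' && up_down a' b' a b.

Lemma adj_sym : symmetric adj.
Proof. by move=> [[a b] []] [[a' b'] []]. Qed.

Lemma adj_irr : irreflexive adj.
Proof. by move=> [[a b] []]. Qed.

(** The trapezoid of height h on a long side of length W, without the cells along
    the long side at the positions in p.  The other oblique side is a + b = W. *)
Definition in_trap W h (p : seq nat) (t : cell) :=
  let: ((a, b), o) := t in
  (a + b < W)%N &&
  (if o then (b < h)%N && ~~ ((b == 0%N) && (a \in p)) else (0 < b <= h)%N).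

(** What remains of the trapezoid when its bottom row is removed from left to
    right.  In that row, the cells with o = true start at position i + s and lack
    those of p, and the cells with o = false start at i; so s = 1 means that one cell
    with o = true too many has gone.  In the next row, q lists the positions of the
    cells already matched with cells of the bottom row. *)
Definition in_peel W h i s (p q : seq nat) (t : cell) :=
  let: ((a, b), o) := t in
  (a + b < W)%N &&
  (if o then (b < h)%N && (if b == 0%N then (i + s <= a)%N && (a \notin p)
                           else if b == 1%N then a \notin q else true)
   else (0 < b <= h)%N && ((b == 1%N) ==> (i <= a)%N)).

Definition cells (W h : nat) (P : pred cell) : {fset cell} :=
  [fset t in [fset a in iota 0 W] `*` [fset b in iota 0 h.+1] `*` [fset true; false]
     | P t].

Lemma in_cells W h (P : pred cell) t :
    (P t -> (t.1.1 < W) && (t.1.2 <= h))%N ->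
  (t \in cells W h P) = P t.
Proof.
case: t => [[a b] o] /= aP; rewrite in_fset inE /=; case Pt: (P _); rewrite ?andbF // andbT.
have /andP[aW bh] := aP Pt.
rewrite !in_fsetM /= !inE /= !mem_iota; move: aW bh; case: (o) => /=; lia.
Qed.

Definition trap W h p := cells W h (in_trap W h p).
Definition peel W h i s p q := cells W h (in_peel W h i s p q).

Lemma mem_trap W h p t : (t \in trap W h p) = in_trap W h p t.
Proof. by apply: in_cells; case: t => [[a b] []] /=; lia. Qed.

Lemma mem_peel W h i s p q t : (t \in peel W h i s p q) = in_peel W h i s p q t.
Proof. by apply: in_cells; case: t => [[a b] []] /=; lia. Qed.

Lemma trap0 W p : trap W 0 p = fset0.
Proof. by apply/fsetP => -[[a b] []]; rewrite mem_trap /= in_fset0; lia. Qed.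


Lemma trap_peel W h p : trap W h p = peel W h 0 0 p [::].
Proof.
apply/fsetP => -[[a b] o]; rewrite mem_trap mem_peel /=.
by case: o; case: (a \in p); case: b => [|[|b]] /=; lia.
Qed.

(** Once the bottom row is used up, the rest is a trapezoid of height one less,
    translated by one row. *)
Lemma nmatch_peel_last W h q :
  nmatch adj (peel W.+1 h.+1 W 1 [::] q) = nmatch adj (trap W h q).
Proof.
pose f (t : cell) : cell := (t.1.1, t.1.2.+1, t.2).
have f_inj : injective f by move=> [[a b] o] [[a' b'] o'] [-> -> ->].
rewrite [RHS](_ : _ = nmatch (relpre f adj) (trap W h q)); last first.
  by apply: eq_in_nmatch => -[[a b] o] [[a' b'] o'] _ _.
rewrite -(nmatch_imfset _ adj_sym adj_irr f_inj).
suff -> : peel W.+1 h.+1 W 1 [::] q = [fset f t | t in trap W h q] by [].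
apply/fsetP => -[[a b] o]; rewrite mem_peel; apply/idP/imfsetP => /=.
  case: b => [|b] H; first by case: o H => /=; rewrite ?in_nil; lia.
  by exists (a, b, o) => //; rewrite mem_trap /=; case: o H; case: (a \in q); case: b => [|b] /=; lia.
case=> -[[a' b'] o']; rewrite mem_trap /= => H [-> -> ->].
by case: o' H; case: (a' \in q); case: b' => [|b'] /=; lia.
Qed.

Lemma peel_mem W h i p q :
  peel W h i 0 (i :: p) q = peel W h i 1 p q.
Proof.
apply/fsetP => -[[a b] o]; rewrite !mem_peel /= !inE.
by case: o; case: (a \in p); case: (a \in q); case: b => [|[|b]] /=; lia.
Qed.

(** The cell with o = true at position i has a single neighbour left, the cell to
    its right, so its lozenge is forced. *)
Lemma nmatch_peel0 W h i p q : (i < W)%N -> (i \notin p) ->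
  nmatch adj (peel W h.+1 i 0 p q) =
    (if i.+1 < W then nmatch adj (peel W h.+1 i.+1 0 p q) else 0)%N.
Proof.
move=> iW ip.
rewrite (nmatch_expand1 adj_sym adj_irr (v := (i, 0%N, true)) (w1 := (i, 1%N, false))).
- rewrite mem_peel /= addn1 leqnn /= andbT.
  case: ifP => // iW'; congr nmatch; apply/fsetP => -[[a b] o].
  rewrite !(mem_peel, in_fsetD, in_fset2) /= !xpair_eqE /=.
  move: ip; have [->|/eqP ai] := eqVneq a i.
    by move=> ip; rewrite ip; case: o => /=; case: (i \in q); case: b => [|[|b]] /=; lia.
  by move=> _; case: o; case: (a \in p); case: (a \in q); case: b => [|[|b]] /=; lia.
- by rewrite mem_peel /= !addn0 iW leqnn ip.
- by rewrite /adj /up_down !eqxx orbT.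
by move=> [[a b] []]; rewrite mem_peel /= /up_down // => H1 H2;
   congr (_, _, _); lia.
Qed.

(** The cell with o = false at position i is covered either together with the cell
    of the next row behind its horizontal edge, which puts i into q, or together
    with the cell to its right, when that one is not a dent. *)
Lemma nmatch_peel1 W h i p q : (i.+1 < W)%N -> (i \notin q) ->
  nmatch adj (peel W h.+1 i 1 p q) =
    ((if 0 < h then nmatch adj (peel W h.+1 i.+1 0 p (rcons q i)) else 0) +
     (if i.+1 \in p then 0 else nmatch adj (peel W h.+1 i.+1 1 p q)))%N.
Proof.
move=> iW iq.
rewrite (nmatch_expand2 adj_sym adj_irr (v := (i, 1%N, false)) (w1 := (i, 1%N, true))
         (w2 := (i.+1, 0%N, true))) //.
- rewrite !mem_peel /= addn1 addn0 iW iq leqnn /= !andbT.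
  congr (_ + _)%N.
    rewrite ltnS; case: ifP => // h0; congr nmatch; apply/fsetP => -[[a b] o].
    rewrite !(mem_peel, in_fsetD, in_fset2) /= !xpair_eqE /= mem_rcons inE.
    move: iq; have [->|/eqP ai] := eqVneq a i.
      by move=> iq; rewrite iq; case: o => /=; case: (i \in p); case: b => [|[|b]] /=; lia.
    by move=> _; case: o; case: (a \in p); case: (a \in q); case: b => [|[|b]] /=; lia.
  case: (boolP (i.+1 \in p)) => //= ip; congr nmatch; apply/fsetP => -[[a b] o].
  rewrite !(mem_peel, in_fsetD, in_fset2) /= !xpair_eqE /=.
  by case: o; case: (a \in p); case: (a \in q); case: b => [|[|b]] /=; lia.
- by rewrite mem_peel /= leqnn addn1 iW.
- by rewrite /adj /up_down !eqxx.
- by rewrite /adj /up_down !eqxx !orbT.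
- by rewrite !xpair_eqE /= andbF.
move=> [[a b] []]; rewrite mem_peel /= /up_down //.
by case: b => [|[|b]] /= H1 H2; [right|left|lia]; congr (_, _, _); lia.
Qed.

(** The sequences q with p_1 <= q_1 < p_2 <= q_2 < ... < p_m, with one element
    less than p.  Nothing interlaces the empty sequence, in accordance with
    the fact that a row without dents has no tiling. *)
Fixpoint interlaced (p : seq nat) : seq (seq nat) :=
  if p is a :: r then
    if r is b :: _ then [seq x :: l | x <- iota a (b - a), l <- interlaced r]
    else [:: [::]]
  else [::].

(** When h = 0 there is no row that could hold the dents, and the graph alone
    would not see them; the value 0 for nonempty q then makes the recursion on h
    uniform. *)
Definition dented W h (q : seq nat) : nat :=
  if h is 0 then (q == [::]) else nmatch adj (trap W h q).

Lemma dentedE W h q : (0 < h)%N || (q == [::]) ->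
  dented W h q = nmatch adj (trap W h q).
Proof. by case: h => //= /eqP ->; rewrite trap0 nmatch0. Qed.

Lemma sum_interlaced_cons (F : seq nat -> nat) i b r : (i < b)%N ->
  (\sum_(l <- interlaced (i :: b :: r)) F l =
   \sum_(l <- interlaced (b :: r)) F (i :: l) +
   (if i.+1 == b then 0 else \sum_(l <- interlaced (i.+1 :: b :: r)) F l))%N.
Proof.
move=> ib; rewrite /= -/(interlaced (b :: r)) -(subnSK ib) /= big_cat big_map /=.
by case: eqP => [->|_] //; rewrite subnn big_nil.
Qed.

(** The two states of the peeling are treated together, by induction on the number
    of positions still to be visited.  Between two consecutive dents exactly one
    cell with o = false is covered from the next row: with s = 1 this cell has not
    been met yet since the last dent, with s = 0 it has, or no dent has been met. *)
Lemma nmatch_peel W h i (q : seq nat) : (i <= W)%N -> all (gtn i) q ->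
    (0 < h)%N || (q == [::]) ->
  (forall p, path ltn i p -> all (geq W) p ->
     nmatch adj (peel W.+1 h.+1 i 1 p q) =
       \sum_(l <- interlaced (i :: p)) dented W h (q ++ l))%N /\
  (forall p, sorted ltn p -> all (geq W) p -> all (leq i) p ->
     nmatch adj (peel W.+1 h.+1 i 0 p q) =
       \sum_(l <- interlaced p) dented W h (q ++ l))%N.
Proof.
have [k] := ubnP (W - i)%N; elim: k i q => // k IH i q lek iW qi hq.
have iq : i \notin q by apply/negP => /(allP qi) /=; rewrite ltnn.
have qi1 : all (gtn i.+1) q by apply: sub_all qi => j /= /ltnW.
have qi2 : all (gtn i.+1) (rcons q i) by rewrite all_rcons qi1 /= ltnSn.
have peel1 : forall p, path ltn i p -> all (geq W) p ->
     nmatch adj (peel W.+1 h.+1 i 1 p q) =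
       (\sum_(l <- interlaced (i :: p)) dented W h (q ++ l))%N.
  move=> p ip pW; have [eiW|iW'] := eqVneq i W.
    have -> : p = [::].
      by case: p ip pW => // b r /= /andP[ib _] /andP[bW _]; move: ib bW; rewrite eiW /= => ? ?; lia.
    by rewrite eiW nmatch_peel_last big_seq1 cats0 dentedE.
  have iltW : (i < W)%N by rewrite ltn_neqAle iW'.
  have k1 : (W - i.+1 < k)%N by lia.
  rewrite nmatch_peel1 // ?ltnS //.
  have [P1 _] := IH i.+1 q k1 iltW qi1 hq.
  case: p ip pW => [_ _|b r ip pW].
    rewrite P1 // big_seq1; case: ifP => // h0.
    have [_ P0] := IH i.+1 (rcons q i) k1 iltW qi2 (introT orP (or_introl h0)).
    by rewrite P0 // big_nil.
  have /andP[ib br] := ip.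
  rewrite sum_interlaced_cons //; congr (_ + _)%N.
    case: ifP => h0.
      have [_ P0] := IH i.+1 (rcons q i) k1 iltW qi2 (introT orP (or_introl h0)).
      rewrite P0 //; last exact: order_path_min ltn_trans ip.
      by apply: eq_bigr => l _; rewrite cat_rcons.
    by rewrite big1 // => l _; case: h h0 {IH P1 hq} => //= _; case: (q).
  rewrite inE orbC; case: (boolP (i.+1 \in r)) => [ir|_] /=.
    by have /= := allP (order_path_min ltn_trans br) _ ir; lia.
  case: eqP => // ib'; apply: P1 => //.
  apply/andP; split=> //; move: (ib : (i < b)%N) ib' => /= ? ?; lia.
split=> // -[|b r] pS pW pi.
  rewrite big_nil nmatch_peel0 ?ltnS //; case: ifP => // iW1.
  have [|_ ->] := IH i.+1 q _ iW1 qi1 hq; rewrite ?big_nil //; lia.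
have [eib|ib] := eqVneq i b.
  rewrite -eib peel_mem peel1 //; first by rewrite eib.
  by case/andP: pW.
have ilb : (i < b)%N by case/andP: pi => /= ib' _; lia.
have ir : i \notin b :: r.
  rewrite inE negb_or ib /=; apply/negP => ir.
  by have /= := allP (order_path_min ltn_trans pS) _ ir; lia.
have iW1 : (i < W)%N by case/andP: pW => /= bW _; lia.
rewrite nmatch_peel0 ?ltnS // iW1.
have [|_ -> //] := IH i.+1 q _ iW1 qi1 hq; first by lia.
rewrite /= ilb; apply: sub_all (order_path_min ltn_trans pS) => j /=; lia.
Qed.

Lemma nmatch_trap_rec W h p : sorted ltn p -> all (geq W) p ->
  nmatch adj (trap W.+1 h.+1 p) = (\sum_(l <- interlaced p) dented W h l)%N.
Proof.
move=> pS pW; rewrite trap_peel.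
have [_ ->//] := @nmatch_peel W h 0 [::] isT isT (orbT _).
by apply/allP.
Qed.

(** The number of Gelfand-Tsetlin patterns with top row p and h rows below it,
    the last one being empty. *)
Fixpoint patterns h (p : seq nat) : nat :=
  if h is h'.+1 then (\sum_(l <- interlaced p) patterns h' l)%N else (p == [::]).

Lemma interlaced_sorted W p l : l \in interlaced p -> sorted ltn p ->
  all (geq W) p -> sorted ltn l /\ all (gtn W) l.
Proof.
case: p => // a r lp pS pW.
suff [] : [/\ sorted ltn l, all (leq a) l & all (gtn W) l] by [].
elim: r a l lp pS pW => [|b r IH] a l; first by rewrite inE => /eqP->.
rewrite [interlaced _]/= -/(interlaced (b :: r)) => /allpairsPdep[x [l' [xab l'r ->]]].
case/andP=> ab br /andP[aW brW]; have [l'S l'b l'W] := IH b l' l'r br brW.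
move: xab; rewrite mem_iota => /andP[ax xb]; have {}xb : (x < b)%N by lia.
have bW : (b <= W)%N by case/andP: brW.
rewrite /= (path_sortedE ltn_trans) l'S l'W ax (leq_trans xb bW) !andbT.
split=> //; first by apply: sub_all l'b => z /= /(leq_trans xb).
by apply: sub_all l'b => z /= bz; lia.
Qed.

Lemma dented_patterns W h p : (h <= W)%N -> sorted ltn p -> all (gtn W) p ->
  dented W h p = patterns h p.
Proof.
elim: h W p => // h IH [|W] p // hW pS pW.
rewrite /= nmatch_trap_rec // big_seq [RHS]big_seq; apply: eq_bigr => l lp.
by have [lS lW] := interlaced_sorted lp pS pW; apply: IH.
Qed.

(** * Counting Gelfand-Tsetlin patterns *)

Import Order.TTheory GRing.Theory Num.Theory.
Local Open Scope ring_scope.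

Lemma size_interlaced p l : l \in interlaced p -> size l = (size p).-1.
Proof.
elim: p l => // a [_ l|b r IH l]; first by rewrite inE => /eqP->.
rewrite [interlaced _]/= -/(interlaced (b :: r)) => /allpairsPdep[x [l' [_ l'r ->]]].
by rewrite /= (IH l').
Qed.

Lemma patterns_size h p : size p != h -> patterns h p = 0%N.
Proof.
elim: h p => [|h IH] [|a p] //= ph; first by rewrite big_nil.
rewrite big_seq big1 // => l lp; apply: IH.
by rewrite (@size_interlaced (a :: p)).
Qed.

(** The entries of an interlacing sequence range independently over the intervals
    [p_i, p_(i+1)), so the sum can be carried out inside each argument of g, where
    it telescopes because f is the difference of F.  Additivity is required only for
    sequences of length n: a determinant ignores, and so is not additive in, the
    entries beyond its size. *)
Lemma sum_interlaced_multilinear (V W : zmodType) (F f : nat -> V) n (g : seq V -> W) p :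
    (forall s1 x y s2, (size s1 + size s2).+1%N = n ->
       g (s1 ++ (x + y) :: s2) = g (s1 ++ x :: s2) + g (s1 ++ y :: s2)) ->
    (forall x, F x.+1 = F x + f x) ->
    sorted leq p -> size p = n.+1 ->
  \sum_(l <- interlaced p) g (map f l)
    = g (pairmap (fun a b => F b - F a) (head 0%N p) (behead p)).
Proof.
case: p => // a r + Ff; elim: r a n g => [|b r IH] a n g g_add /=.
  by rewrite big_seq1.
case/andP=> ab br [nE]; rewrite -/(interlaced (b :: r)) big_allpairs_dep /=.
have step x : \sum_(l <- interlaced (b :: r)) g (f x :: map f l)
      = g (f x :: pairmap (fun a b => F b - F a) b r).
  rewrite (IH b (size r) (fun s => g (f x :: s))) // => s1 u v s2 s12.
  by apply: (g_add (f x :: s1)); rewrite -nE -s12.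
rewrite (eq_bigr _ (fun x _ => step x)); move: (pairmap _ _ _) (size_pairmap (fun a b => F b - F a) b r).
move=> s ss; have gD u v : g ((u + v) :: s) = g (u :: s) + g (v :: s).
  by apply: (g_add [::]); rewrite -nE -ss.
have g0 : g (0 :: s) = 0 by apply: (@addrI _ (g (0 :: s))); rewrite -gD !addr0.
rewrite -{2}(subnKC ab); move: (b - a)%N => k; elim: k a {ab br step} => [|k IHk] a.
  by rewrite big_nil addn0 subrr.
rewrite /= big_cons IHk -gD addSnnS; congr (g (_ :: _)).
by rewrite Ff opprD addrC -!addrA addNr addr0.
Qed.

Definition bin_row n x : 'rV[rat]_n := \row_(j < n) 'C(x, j)%:R.

Definition det_rows n (s : seq 'rV[rat]_n) : rat := \det (\matrix_(i < n) nth 0 s i).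

Lemma det_rows_add n s1 x y s2 : (size s1 + size s2).+1%N = n ->
  @det_rows n (s1 ++ (x + y) :: s2) = det_rows (s1 ++ x :: s2) + det_rows (s1 ++ y :: s2).
Proof.
move=> nE; have i0P : (size s1 < n)%N.
  by move: nE; move: (size s1) (size s2) => a b <-; rewrite ltnS leq_addr.
pose i0 := Ordinal i0P.
have row0 z : row i0 (\matrix_(i < n) nth 0 (s1 ++ z :: s2) i) = z.
  by rewrite rowK nth_cat ltnn subnn.
have row'0 z z' : row' i0 (\matrix_(i < n) nth 0 (s1 ++ z :: s2) i)
    = row' i0 (\matrix_(i < n) nth 0 (s1 ++ z' :: s2) i).
  apply/row_matrixP => i; apply/rowP => j; rewrite !mxE !nth_cat.
  case: ltnP => // le; case E: (_ - _)%N => //; case/eqP: (neq_lift i0 i).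
  by apply: ord_inj; apply/eqP; rewrite eqn_leq le -subn_eq0 E.
rewrite /det_rows -[X in _ = X + _]mul1r -[X in _ = _ + X]mul1r.
by apply: (determinant_multilinear (i0 := i0)); rewrite ?scale1r ?row0 //.
Qed.

(** Subtracting from each row the previous one clears the first column, whose
    entries are all 'C(_, 0) = 1. *)
Lemma det_bin_rows_diff n a (p : seq nat) : size p = n ->
  det_rows (map (bin_row n.+1) (a :: p)) =
  det_rows (pairmap (fun x y => (\row_(j < n) 'C(y, j.+1)%:R) - (\row_(j < n) 'C(x, j.+1)%:R)) a p).
Proof.
move=> pn; rewrite /det_rows; set M := \matrix_(i < n.+1) _.
pose L : 'M[rat]_n.+1 := \matrix_(i, j) ((i == j)%:R - (i == j.+1 :> nat)%:R).
have ML i j : M i j = 'C(nth 0%N (a :: p) i, j)%:R.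
  rewrite mxE (nth_map 0%N) ?mxE //= pn; exact: ltn_ord.
have detL : \det L = 1.
  rewrite det_trig; last first.
    apply/is_trig_mxP => i j ij; rewrite mxE; move: ij.
    have [->|_] := eqVneq i j; first by rewrite ltnn.
    by move=> ij; rewrite ltn_eqF ?subr0 // ltnS ltnW.
  by rewrite big1 // => i _; rewrite mxE eqxx ltn_eqF // subr0.
have LM0 j : (L *m M) ord0 j = M ord0 j.
  rewrite mxE (bigD1 ord0) //= mxE eqxx subr0 mul1r big1 ?addr0 // => k k0.
  by rewrite mxE eq_sym (negbTE k0) subr0 mul0r.
have LMS (i : 'I_n) j : (L *m M) (lift ord0 i) j = M (lift ord0 i) j - M (widen_ord (leqnSn n) i) j.
  rewrite mxE (bigD1 (lift ord0 i)) //= (bigD1 (widen_ord (leqnSn n) i)) /=; last first.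
    by rewrite -val_eqE /= /bump /= add1n ltn_eqF.
  rewrite !mxE eqxx /= /bump /= add1n eqn_leq ltnn andbF subr0 mul1r eqxx.
  rewrite -val_eqE /= /bump /= add1n gtn_eqF // sub0r mulN1r big1 ?addr0 // => k /andP[k1 k2].
  rewrite mxE eq_sym (negbTE k1) /= /bump /= add1n eqSS eq_sym.
  by move: k2; rewrite -val_eqE /= => /negbTE->; rewrite subr0 mul0r.
have -> : \det M = \det (L *m M) by rewrite det_mulmx detL mul1r.
rewrite (expand_det_col _ ord0) big_ord_recl big1 => [|i _]; last first.
  by rewrite LMS !ML !bin0 subrr mul0r.
rewrite LM0 ML bin0 mul1r addr0 /cofactor addn0 expr0 mul1r; congr (\det _).
apply/matrixP => i j; rewrite mxE [in LHS]mxE LMS !ML [RHS]mxE.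
rewrite (nth_pairmap 0%N) ?pn // !mxE /= /bump !leq0n !add1n //.
Qed.

Definition superfact n : rat := \prod_(j < n) (j`!)%:R.

Lemma superfact_neq0 n : superfact n != 0.
Proof. by apply/prodf_neq0 => i _; rewrite pnatr_eq0 -lt0n fact_gt0. Qed.

Definition falling j : {poly rat} := \prod_(k <- iota 0 j) ('X - k%:R%:P).

Lemma falling_horner j x : (falling j).[x%:R] = (x ^_ j)%:R.
Proof.
elim: j => [|j IH]; first by rewrite /falling big_nil hornerC.
rewrite /falling -addn1 iotaD big_cat /= big_seq1 hornerM -/(falling j) IH addn1 ffactnSr natrM.
rewrite hornerXsubC; have [jx|xj] := leqP j x; first by rewrite natrB.
by rewrite ffact_small // !mul0r.
Qed.

(** As a polynomial in x, 'C(x, j) has degree j and leading coefficient 1 / j!, so a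
    triangular change of basis turns the matrix into a Vandermonde matrix. *)
Lemma det_bin_rows n (x : 'I_n -> nat) :
  \det (\matrix_(i < n) bin_row n (x i)) =
  (\prod_(i < n) \prod_(j < n | (i < j)%N) ((x j)%:R - (x i)%:R)) / superfact n.
Proof.
pose T : 'M[rat]_n := \matrix_(k, j) ((falling j)`_k / (j`!)%:R).
have fact0 j : (j`!)%:R != 0 :> rat by rewrite pnatr_eq0 -lt0n fact_gt0.
have -> : \matrix_(i < n) bin_row n (x i) = (Vandermonde n (\row_i (x i)%:R))^T *m T.
  apply/matrixP => i j; rewrite !mxE.
  have -> : 'C(x i, j)%:R = (falling j).[(x i)%:R] / (j`!)%:R.
    by rewrite falling_horner -bin_ffact natrM mulfK.
  rewrite (@horner_coef_wide _ n); last by rewrite size_prod_XsubC size_iota ltn_ord.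
  rewrite mulr_suml; apply: eq_bigr => k _; rewrite !mxE; ring.
rewrite det_mulmx det_tr det_Vandermonde -(det_tr T) (det_trig (A := T^T)); last first.
  apply/is_trig_mxP => i j ij; rewrite !mxE nth_default ?mul0r //.
  by rewrite size_prod_XsubC size_iota.
congr (_ * _).
  by apply: eq_bigr => i _; apply: eq_bigr => j _; rewrite !mxE.
rewrite /superfact -prodfV; apply: eq_bigr => i _; rewrite !mxE.
have /monicP : falling i \is monic by apply: monic_prod_XsubC.
by rewrite /lead_coef size_prod_XsubC size_iota /= => ->; rewrite mul1r.
Qed.

(** By Pascal's rule the row 'C(x, j) is the difference of 'C(x, j + 1), so summing the
    determinant of size n over the interlacing sequences gives the determinant of
    differences, which is the determinant of size n + 1. *)
Lemma patterns_det n (p : seq nat) : sorted ltn p -> size p = n ->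
  (patterns n p)%:R = det_rows (map (bin_row n) p).
Proof.
elim: n p => [|n IH] p pS pn.
  by rewrite (size0nil pn) /det_rows det_mx00.
rewrite [patterns _ _]/= natr_sum.
have -> : \sum_(l <- interlaced p) (patterns n l)%:R
    = \sum_(l <- interlaced p) det_rows (map (bin_row n) l).
  rewrite big_seq [RHS]big_seq; apply: eq_bigr => l lp; apply: IH; last first.
    by rewrite (size_interlaced lp) pn.
  have pmax : all (geq (\max_(x <- p) x)) p.
    by apply/allP => x xp; apply: leq_bigmax_seq.
  by have [] := interlaced_sorted lp pS pmax.
have binD x : (\row_(j < n) 'C(x.+1, j.+1)%:R : 'rV[rat]_n) = (\row_(j < n) 'C(x, j.+1)%:R) + bin_row n x.
  by apply/rowP => j; rewrite !mxE binS natrD.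
have leS : sorted leq p by apply: sub_sorted pS => x y /ltnW.
apply: etrans (sum_interlaced_multilinear (@det_rows_add n) binD leS pn) _.
by case: p {leS} pS pn => // a p pS [pn]; rewrite det_bin_rows_diff.
Qed.

(** For the points 0, ..., n - 1 the binomial matrix is unitriangular. *)
Lemma prod_diff_ord n :
  \prod_(i < n) \prod_(j < n | (i < j)%N) (j%:R - i%:R) = superfact n.
Proof.
have sf0 := superfact_neq0 n.
have := det_bin_rows (fun i : 'I_n => i : nat); rewrite det_trig; last first.
  by apply/is_trig_mxP => i j ij; rewrite !mxE bin_small.
rewrite big1 => [/eqP|i _]; last by rewrite !mxE binn.
by rewrite eq_sym -(inj_eq (mulIf sf0)) mul1r divfK // => /eqP.
Qed.

Lemma patterns_diff_prod r m (s : 'I_r -> 'I_m) :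
    (forall i j : 'I_r, (i < j)%N -> (s i < s j)%N) ->
  (patterns r [seq val (s i) | i <- enum 'I_r])%:R = diff_prod s.
Proof.
move=> s_incr; rewrite patterns_det; last 2 first.
- rewrite sorted_map; apply: (@sub_sorted _ (relpre val ltn)) => [i j|]; first exact: s_incr.
  by rewrite -sorted_map val_enum_ord iota_ltn_sorted.
- by rewrite size_map size_enum_ord.
have rowsE (x : 'I_r -> nat) : det_rows (map (bin_row r) [seq x i | i <- enum 'I_r])
   = \det (\matrix_(i < r) bin_row r (x i)).
  congr (\det _); apply/matrixP => i j; rewrite mxE [RHS]mxE -map_comp.
  by rewrite (nth_map i) ?size_enum_ord // nth_ord_enum.
rewrite rowsE det_bin_rows -prod_diff_ord /diff_prod -prodf_div; apply: eq_bigr => i _.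
by rewrite prodf_div.
Qed.

(** * The two halves of the hexagon *)

Lemma cardfs3I (K : choiceType) (p q r : K) (B : {fset K}) :
    p != q -> p != r -> q != r ->
  #|` [fset p; q; r] `&` B| = ((p \in B) + (q \in B) + (r \in B))%N.
Proof.
move=> pq pr qr.
have -> : [fset p; q; r] `&` B = [fset z in [fset p; q; r] | z \in B].
  by apply/fsetP => z; rewrite !inE.
rewrite card_fset_sum1 big_fset /= big_mkcond /=.
have -> : [fset p; q; r] = p |` (q |` [fset r]) by rewrite -fsetUA.
rewrite !big_fsetU1 ?inE ?negb_or ?pq ?pr //= big_seq_fset1 addnA.
by do 3!case: (_ \in B).
Qed.

Definition updn (a b a' b' : int) :=
  [|| (a' == a) && (b' == b), (a' == a) && (b' == b + 1)
    | (a == a' + 1) && (b' == b + 1)].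

(** Two triangles share an edge when they have exactly two common vertices; after
    substituting a' = a + x and b' = b + y only finitely many x, y matter. *)
Lemma share_edgeE a b o a' b' o' :
  share_edge ((a, b), o) ((a', b'), o') =
    if o then ~~ o' && updn a b a' b' else o' && updn a' b' a b.
Proof.
rewrite /share_edge /vertices cardfs3I; first last.
- by case: o; rewrite xpair_eqE; lia.
- by case: o; rewrite xpair_eqE; lia.
- by rewrite xpair_eqE; lia.
have [x ->] : exists x, a' = a + x by exists (a' - a); ring.
have [y ->] : exists y, b' = b + y by exists (b' - b); ring.
have shift (z w c d : int) : (z + c == z + w + d) = (w == c - d) by lia.
have shift0 (z w : int) : (z == z + w) = (w == 0) by lia.
have shift2 (z w d : int) : (z == z + w + d) = (w == - d) by lia.
have shift3 (z w : int) : (z + w == z) = (w == 0) by lia.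
have shift4 (z w c : int) : (z + w == z + c) = (w == c) by lia.
rewrite /updn !inE; case: o; case: o' => /=; rewrite !xpair_eqE /= ?(shift, shift2, shift0, shift3).
all: rewrite ?shift4.
all: have [x0|_] := eqVneq x 0; [|have [x0|_] := eqVneq x 1; [|have [x0|_] := eqVneq x (-1)]].
all: rewrite ?x0 //=.
all: have [y0|_] := eqVneq y 0; [|have [y0|_] := eqVneq y 1; [|have [y0|_] := eqVneq y (-1)]].
all: rewrite ?y0 //=.
all: rewrite ?andbF ?orbF //=.
all: by case: (y == _).
Qed.

(** In the lower half, the position of a cell is read off after the reflection in
    the line l, which exchanges the two orientations; the shift of the first coordinate
    by b comes from the obliqueness of the coordinates. *)
Definition upper_cell (t : cell) : triangle := ((t.1.1%:Z, t.1.2%:Z), t.2).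
Definition lower_cell (t : cell) : triangle :=
  ((t.1.1%:Z + t.1.2%:Z, - t.1.2%:Z), ~~ t.2).

Lemma upper_cell_inj : injective upper_cell.
Proof. by move=> [[a b] o] [[a' b'] o'] [-> -> ->]. Qed.

Lemma lower_cell_inj : injective lower_cell.
Proof.
move=> [[a b] o] [[a' b'] o'] [ab bb /negb_inj->].
by congr (_, _, _); lia.
Qed.

Lemma share_edge_upper s t : share_edge (upper_cell s) (upper_cell t) = adj s t.
Proof.
case: s => [[a b] o]; case: t => [[a' b'] o']; rewrite /upper_cell share_edgeE /=.
by rewrite /updn /up_down; case: o; case: o' => //=; lia.
Qed.

Lemma share_edge_lower s t : share_edge (lower_cell s) (lower_cell t) = adj s t.
Proof.
case: s => [[a b] o]; case: t => [[a' b'] o']; rewrite /lower_cell share_edgeE /=.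
by rewrite /updn /up_down; case: o; case: o' => //=; lia.
Qed.

Lemma share_edge_sym : symmetric share_edge.
Proof. by move=> s t; rewrite /share_edge fsetIC. Qed.

Lemma share_edge_irr : irreflexive share_edge.
Proof. by move=> [[a b] []]; rewrite share_edgeE. Qed.

Lemma mem_upper_cell (R : {fset cell}) a b o :
  (((a, b), o) \in [fset upper_cell t | t in R]) =
    [&& 0 <= a, 0 <= b & (absz a, absz b, o) \in R].
Proof.
apply/imfsetP/and3P => /= [[[[a' b'] o'] tR [-> -> ->]]|[a0 b0 tR]]; first by rewrite !absz_nat.
by exists (absz a, absz b, o); rewrite // /upper_cell /= !gez0_abs.
Qed.

Lemma mem_lower_cell (R : {fset cell}) a b o :
  (((a, b), o) \in [fset lower_cell t | t in R]) =
    [&& 0 <= a + b, b <= 0 & (absz (a + b), absz b, ~~ o) \in R].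
Proof.
apply/imfsetP/and3P => /= [[[[a' b'] o'] tR [-> -> ->]]|[ab b0 tR]].
  by rewrite addrK abszN negbK !absz_nat; split => //; lia.
exists (absz (a + b), absz b, ~~ o); rewrite // /lower_cell /= negbK.
by congr (_, _, _); lia.
Qed.

Section Halves.
Variables (W : nat).
Implicit Types (S U D V B : {set 'I_W}).

Definition positions S : seq nat := [seq val i | i <- enum S].

Lemma mem_positions S (i : 'I_W) : (val i \in positions S) = (i \in S).
Proof. by rewrite mem_map ?mem_enum //; apply: val_inj. Qed.

Lemma positionsP S a : reflect (exists2 i, i \in S & a = val i) (a \in positions S).
Proof.
apply: (iffP mapP) => [[i]|[i iS ->]]; first by rewrite mem_enum => iS ->; exists i.
by exists i; rewrite ?mem_enum.
Qed.

Lemma positions_sorted S : sorted ltn (positions S).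
Proof.
rewrite sorted_map /enum_mem; apply: sorted_filter => [???|]; first exact: ltn_trans.
by rewrite -enumT -sorted_map val_enum_ord iota_ltn_sorted.
Qed.

Lemma positions_lt S : all (gtn W) (positions S).
Proof. by apply/allP => _ /positionsP[i _ ->]; apply: ltn_ord. Qed.

Lemma size_positions S : size (positions S) = #|S|.
Proof. by rewrite size_map -cardE. Qed.

Lemma mem_up_at S a b o :
  (((a, b), o) \in [fset up_at (val i) | i in S]) =
    [&& o, b == 0, 0 <= a & absz a \in positions S].
Proof.
apply/imfsetP/and4P => /= [[i iS [-> -> ->]]|[-> /eqP-> a0 /positionsP[i iS ai]]].
  by rewrite absz_nat mem_positions.
by exists i => //; rewrite /up_at -ai gez0_abs.
Qed.

Lemma mem_down_at S a b o :
  (((a, b), o) \in [fset down_at (val i) | i in S]) =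
    [&& ~~ o, b == 0, 0 <= a & absz a \in positions S].
Proof.
apply/imfsetP/and4P => /= [[i iS [-> -> ->]]|[/negbTE-> /eqP-> a0 /positionsP[i iS ai]]].
  by rewrite absz_nat mem_positions.
by exists i => //; rewrite /down_at -ai gez0_abs.
Qed.

Definition upper h S := [fset upper_cell t | t in trap W h (positions S)].
Definition lower h S := [fset lower_cell t | t in trap W h (positions S)].

Lemma mem_upper h S a b o : (((a, b), o) \in upper h S) =
  [&& 0 <= a, 0 <= b, a + b < W%:Z & if o then (b < h%:Z) && ~~ ((b == 0) && (absz a \in positions S)) else 0 < b <= h%:Z].
Proof.
rewrite mem_upper_cell mem_trap /=; case: o; case: (absz a \in positions S); lia.
Qed.

Lemma mem_lower h S a b o : (((a, b), o) \in lower h S) =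
  [&& 0 <= a + b, b <= 0, a < W%:Z & if o then - h%:Z <= b < 0 else (- h%:Z < b) && ~~ ((b == 0) && (absz a \in positions S))].
Proof.
rewrite mem_lower_cell mem_trap /=; have [->|b0] := eqVneq b 0.
  by rewrite addr0; case: o; case: (absz a \in positions S) => /=; lia.
by case: o => /=; case: (absz a \in positions S) => /=; lia.
Qed.

(** Both halves have the part of l inside the hexagon, of length W, as long side. *)
Lemma hexagon_split N N' h k U D : (N + h = W)%N -> (N' + k = W)%N ->
  hexagon N N' h k `\` [fset up_at (val i) | i in U] `\` [fset down_at (val i) | i in D]
    = upper h U `|` lower k D.
Proof.
move=> Nh N'k; apply/fsetP => -[[a b] o].
rewrite in_fsetD mem_down_at in_fsetD mem_up_at in_fsetU mem_upper mem_lower.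
have -> : (((a, b), o) \in hexagon N N' h k) =
  [&& in_hexagon N N' h k (a, b), in_hexagon N N' h k (a + 1, b)
    & in_hexagon N N' h k (if o then (a, b + 1) else (a + 1, b - 1))].
  rewrite /hexagon in_fset inE /= in_fsetM /= mem_hexagon_points.
  rewrite !fsubUset !fsub1set !mem_hexagon_points.
  by case: o; rewrite !inE /= ?andbT; case: (in_hexagon _ _ _ _ (a, b)); rewrite /= ?andbT ?andbF.
rewrite /in_hexagon Nh N'k.
case: o => /=; case: (absz a \in positions U); case: (absz a \in positions D) => /=; lia.
Qed.
End Halves.

Section HalvesCount.
Variables (W : nat).
Implicit Types (S U D V B : {set 'I_W}).

Lemma nmatch_upper h S : (h <= W)%N -> (0 < h)%N || (S == set0) ->
  nmatch share_edge (upper h S) = patterns h (positions S).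
Proof.
move=> hW hS; rewrite (nmatch_imfset _ share_edge_sym share_edge_irr upper_cell_inj).
rewrite -(dented_patterns hW (positions_sorted S) (positions_lt S)) dentedE; last first.
  by case/orP: hS => [->//|/eqP->]; rewrite /positions enum_set0 orbT.
by apply: eq_in_nmatch => s t _ _; apply: share_edge_upper.
Qed.

Lemma nmatch_lower h S : (h <= W)%N -> (0 < h)%N || (S == set0) ->
  nmatch share_edge (lower h S) = patterns h (positions S).
Proof.
move=> hW hS; rewrite (nmatch_imfset _ share_edge_sym share_edge_irr lower_cell_inj).
rewrite -(dented_patterns hW (positions_sorted S) (positions_lt S)) dentedE; last first.
  by case/orP: hS => [->//|/eqP->]; rewrite /positions enum_set0 orbT.
by apply: eq_in_nmatch => s t _ _; apply: share_edge_lower.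
Qed.

Lemma mem_positionsU U V a :
  (a \in positions (U :|: V)) = (a \in positions U) || (a \in positions V).
Proof.
apply/positionsP/orP => [[i /setUP[iS|iS] ->]|[]/positionsP[i iS ->]].
- by left; rewrite mem_positions.
- by right; rewrite mem_positions.
- by exists i; rewrite // inE iS.
by exists i; rewrite // inE iS orbT.
Qed.

Lemma upperD h U V : upper h U `\` [fset up_at (val i) | i in V] = upper h (U :|: V).
Proof.
apply/fsetP => -[[a b] o]; rewrite in_fsetD mem_up_at !mem_upper mem_positionsU.
by case: o; case: (absz a \in positions U); case: (absz a \in positions V) => /=; lia.
Qed.

Lemma lowerD h D V : lower h D `\` [fset down_at (val i) | i in V] = lower h (D :|: V).
Proof.
apply/fsetP => -[[a b] o]; rewrite in_fsetD mem_down_at !mem_lower mem_positionsU.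
by case: o; case: (absz a \in positions D); case: (absz a \in positions V) => /=; lia.
Qed.

Lemma up_at_upper h U (i : 'I_W) : (up_at (val i) \in upper h U) = (0 < h)%N && (i \notin U).
Proof.
rewrite mem_upper /= mem_positions; have := ltn_ord i.
by case: (i \in U) => /=; lia.
Qed.

Lemma down_at_lower h D (i : 'I_W) : (down_at (val i) \in lower h D) = (0 < h)%N && (i \notin D).
Proof.
rewrite mem_lower /= mem_positions; have := ltn_ord i.
by case: (i \in D) => /=; lia.
Qed.

Lemma upper_lower_disjoint h k U D : [disjoint upper h U & lower k D].
Proof.
apply/fdisjointP => -[[a b] o]; rewrite mem_upper mem_lower.
by case: o; case: (absz a \in positions U); case: (absz a \in positions D) => /=; lia.
Qed.

(** A tiling avoids the barriers exactly when it is a perfect matching of the graph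
    in which the edges across the barriers are deleted. *)
Definition open_edge B (s t : triangle) :=
  share_edge s t && ~~ [exists i in B, [fset s; t] == vertical_lozenge (val i)].

Lemma open_edge_sym B : symmetric (open_edge B).
Proof. by move=> s t; rewrite /open_edge share_edge_sym fsetUC. Qed.

Lemma open_edge_irr B : irreflexive (open_edge B).
Proof. by move=> s; rewrite /open_edge share_edge_irr. Qed.

Lemma open_edge_upper B h S :
  {in upper h S &, open_edge B =2 share_edge}.
Proof.
move=> s t sS tS; rewrite /open_edge; case: (share_edge s t) => //=.
apply/negP => /existsP[i /andP[_ /eqP st]].
have : down_at (val i) \in upper h S.
  have : down_at (val i) \in [fset s; t] by rewrite st !inE eqxx orbT.
  by rewrite !inE => /orP[]/eqP->.
by rewrite mem_upper ltxx !andbF.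
Qed.

Lemma open_edge_lower B h S :
  {in lower h S &, open_edge B =2 share_edge}.
Proof.
move=> s t sS tS; rewrite /open_edge; case: (share_edge s t) => //=.
apply/negP => /existsP[i /andP[_ /eqP st]].
have : up_at (val i) \in lower h S.
  have : up_at (val i) \in [fset s; t] by rewrite st !inE eqxx.
  by rewrite !inE => /orP[]/eqP->.
by rewrite mem_lower ltxx !andbF.
Qed.

Lemma fset2_eq (K : choiceType) (s t u v : K) : u != v ->
  ([fset s; t] == [fset u; v]) = ((s == u) && (t == v)) || ((s == v) && (t == u)).
Proof.
move=> uv; apply/eqP/orP => [E|]; last first.
  by case=> /andP[/eqP-> /eqP->] //; rewrite fsetUC.
have : s \in [fset u; v] by rewrite -E !inE eqxx.
have : t \in [fset u; v] by rewrite -E !inE eqxx orbT.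
have uE : u \in [fset s; t] by rewrite E !inE eqxx.
have vE : v \in [fset s; t] by rewrite E !inE eqxx orbT.
move: uE vE; rewrite !inE => + + /orP[]/eqP tu /orP[]/eqP su; rewrite tu su ?eqxx ?orbb //=.
- by move=> _ /eqP vu; rewrite vu eqxx in uv.
- by right.
- by left.
by move=> /eqP vu; rewrite vu eqxx in uv.
Qed.

(** Only the two triangles on either side of a segment of l are adjacent across l. *)
Lemma open_edge_cross B h k U D s t : s \in upper h U -> t \in lower k D ->
  open_edge B s t = [exists i in ~: B, (s == up_at (val i)) && (t == down_at (val i))].
Proof.
move=> sU tD; apply/idP/existsP => [|[i /and3P[iB /eqP-> /eqP->]]]; last first.
  rewrite /open_edge share_edgeE /updn !eqxx /=; apply/existsP => -[j /andP[jB]].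
  rewrite fset2_eq; last by rewrite /up_at /down_at xpair_eqE andbF.
  case/orP=> [/andP[/eqP[/ord_inj ij] _]|/andP[/eqP[]]] //.
  by move: iB; rewrite inE ij jB.
move=> /andP[st /existsPn nB].
suff [i /andP[si ti]] : exists i : 'I_W, (s == up_at (val i)) && (t == down_at (val i)).
  exists i; rewrite si ti inE !andbT; apply: contraTN isT => iB.
  by have := nB i; rewrite iB (eqP si) (eqP ti) eqxx.
move: s t sU tD st {nB} => [[a b] o] [[a' b'] o'] sU tD.
have [a0 b0 aW bo] : [/\ 0 <= a, 0 <= b, a + b < W%:Z & o || (0 < b)].
  by move: sU; rewrite mem_upper; case: o => /and4P[-> -> -> //] /andP[->].
have [b'0 b'o] : b' <= 0 /\ ~~ o' || (b' < 0).
  by move: tD; rewrite mem_lower; case: o' => /and4P[_ -> _ //] /andP[_ ->].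
rewrite share_edgeE /updn => st.
have [oT o'F bb b'E a'E] : [/\ o, ~~ o', b = 0, b' = 0 & a' = a].
  by move: bo b'o st; case: o {sU}; case: o' {tD} => //= *; split => //; lia.
have aP : (absz a < W)%N by lia.
exists (Ordinal aP); rewrite /up_at /down_at /= gez0_abs // bb b'E a'E oT (negbTE o'F).
by rewrite !eqxx.
Qed.

End HalvesCount.

Section Region.
Variables (x y n : nat).
Implicit Types (U D V B : {set 'I_(x + y + n)%N}).

Lemma H_tilingsE U D B :
  H_tilings U D B = matchings (open_edge B) (H_region U D).
Proof.
apply/fsetP => T; rewrite /H_tilings.
have -> : tilings (H_region U D) = matchings share_edge (H_region U D) by [].
rewrite in_fset inE /=; apply/andP/matchingsP => [[/matchingsP[edT trT cT] /forallP nB]|[edT trT cT]].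
  split=> // L LT; have [s [t [st LE]]] := is_edgeP _ _ (edT L LT).
  apply/is_edgeP; exists s, t; split=> //; rewrite /open_edge st /=.
  apply/existsP => -[i /andP[iB /eqP sti]].
  by have := nB i; rewrite iB -sti -LE LT.
split.
  apply/matchingsP; split=> // L LT; have [s [t [/andP[st _] LE]]] := is_edgeP _ _ (edT L LT).
  by apply/is_edgeP; exists s, t.
apply/forall_inP => i iB; apply/negP => iT.
have [s [t [/andP[_ /existsPn nB] LE]]] := is_edgeP _ _ (edT _ iT).
by have := nB i; rewrite iB -LE eqxx.
Qed.

(** The cutting formula along l.  A set V with the wrong number of elements
    contributes 0, as then the number of dents of a half differs from its height. *)
Lemma M_H_sum U D B : (#|U| <= n)%N -> (#|D| <= n)%N ->
  M_H U D B =
    (\sum_(V : {set 'I_(x + y + n)%N} | (#|V| == y) && [disjoint V & U :|: D :|: B])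
       patterns (y + #|U|) (positions (U :|: V)) *
       patterns (y + #|D|) (positions (D :|: V)))%N.
Proof.
move=> Un Dn; rewrite /M_H H_tilingsE -/(nmatch _ _) /H_region.
set W := (x + y + n)%N; set h := (y + #|U|)%N; set k := (y + #|D|)%N.
have hW : (h <= W)%N by rewrite /h /W; lia.
have kW : (k <= W)%N by rewrite /k /W; lia.
rewrite (@hexagon_split W) //; try by rewrite /h /k /W; lia.
have up_inj : injective (fun i : 'I_W => up_at (val i)) by move=> i j [/ord_inj].
have down_inj : injective (fun i : 'I_W => down_at (val i)) by move=> i j [/ord_inj].
rewrite (nmatch_cut (@open_edge_sym _ B) (@open_edge_irr _ B) up_inj down_inj
  (upper_lower_disjoint h k U D)
  (fun s t sU tD => open_edge_cross B sU tD)).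
have crossE V : crossing (fun i : 'I_W => up_at (val i)) (fun i : 'I_W => down_at (val i))
    (~: B) (upper h U) (lower k D) V =
  [disjoint V & U :|: D :|: B] && ((0 < h)%N && (0 < k)%N || (V == set0)).
  rewrite /crossing disjoint_subset; have [->|V0] := eqVneq V set0.
    rewrite orbT andbT; apply/forall_inP/subsetP => _ i; rewrite in_set0 //.
  rewrite orbF; apply/forall_inP/andP => [H|[/subsetP H /andP[h0 k0]] i iV].
    split; last first.
      have /set0Pn[i iV] := V0.
      by have /and3P[_] := H i iV; rewrite up_at_upper down_at_lower => /andP[-> _] /andP[-> _].
    apply/subsetP => i /H; rewrite up_at_upper down_at_lower !inE => /and3P[iB /andP[_ iU] /andP[_ iD]].
    by rewrite !negb_or iU iD iB.
  rewrite up_at_upper down_at_lower h0 k0 /=; have := H i iV.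
  by rewrite !inE !negb_or => /andP[/andP[-> ->] ->].
(* a half of height 0 has no dents of its own, and then V is empty *)
have side m (S : {set 'I_W}) V : ((0 < h)%N && (0 < k)%N || (V == set0)) ->
    (m = h \/ m = k) -> m = (y + #|S|)%N -> (0 < m)%N || (S :|: V == set0).
  case/orP=> [/andP[h0 k0] [->|->] _|/eqP-> _ mE]; rewrite ?h0 ?k0 //.
  by rewrite finset.setU0 -cards_eq0; lia.
rewrite (eq_bigl _ _ crossE) (eq_bigr (fun V => patterns h (positions (U :|: V)) *
     patterns k (positions (D :|: V))))%N; last first.
  move=> V /andP[_ hkV]; congr (_ * _)%N.
    rewrite upperD (eq_in_nmatch (@open_edge_upper _ B h _)) nmatch_upper //.
    by apply: side hkV _ _; [left|].
  rewrite lowerD (eq_in_nmatch (@open_edge_lower _ B k _)) nmatch_lower //.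
  by apply: side hkV _ _; [right|].
rewrite (bigID (fun V : {set 'I_W} => #|V| == y)) /= [X in (_ + X)%N]big1 ?addn0 => [|V]; last first.
  case/andP=> /andP[dV _] Vy; rewrite patterns_size // size_positions cardsU.
  have -> : U :&: V = set0.
    by apply/eqP; rewrite setI_eq0 disjoint_sym; apply: disjointWr dV; rewrite -finset.setUA subsetUl.
  by rewrite cards0 subn0 /h addnC eqn_add2r.
apply: eq_bigl => V; rewrite [RHS]andbC -andbA; congr (_ && _).
have [Vy|] := eqVneq #|V| y; rewrite ?andbT ?andbF //.
apply/orP; have [y0|y0] := posnP y; last by left; rewrite /h /k !addn_gt0 y0.
by right; rewrite -cards_eq0 Vy y0.
Qed.
End Region.

(** * Products of differences *)

Local Close Scope fset_scope.

Lemma superfactS n : superfact n.+1 = superfact n * n`!%:R.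
Proof. by rewrite /superfact big_ord_recr. Qed.

(** The product over k telescopes, the product over j is then a quotient of
    factorials, and the product over i one of superfactorials. *)
Lemma PP_superfact a b c :
  PP a b c = superfact a * superfact b * superfact c * superfact (a + b + c) /
             (superfact (a + b) * superfact (b + c) * superfact (a + c)).
Proof.
have nat0 m : m.+1%:R != 0 :> rat by rewrite pnatr_eq0.
have fact0 m : m`!%:R != 0 :> rat by rewrite pnatr_eq0 -lt0n fact_gt0.
have boxk i j m : \prod_(1 <= k < m.+1) (((i.+1 + j.+1 + k)%:R - 1) / ((i.+1 + j.+1 + k)%:R - 2))
    = (i + j + m).+1%:R / (i + j).+1%:R :> rat.
  elim: m => [|m IH]; first by rewrite big_geq // addn0 divff.
  rewrite big_nat_recr //= IH.
  have -> : (i.+1 + j.+1 + m.+1)%:R - 1 = (i + j + m.+1).+1%:R :> rat.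
    by rewrite !natrD -!natr1 !natrD -!natr1; ring.
  have -> : (i.+1 + j.+1 + m.+1)%:R - 2 = (i + j + m).+1%:R :> rat.
    by rewrite !natrD -!natr1 !natrD; ring.
  by rewrite mulrC mulrA divfK.
have boxj i m : \prod_(1 <= j < m.+1) \prod_(1 <= k < c.+1)
      (((i.+1 + j + k)%:R - 1) / ((i.+1 + j + k)%:R - 2))
    = (i + m + c)`!%:R * i`!%:R / ((i + c)`!%:R * (i + m)`!%:R) :> rat.
  elim: m => [|m IH].
    by rewrite big_geq // addn0 divff // mulf_neq0.
  rewrite big_nat_recr //= IH boxk addnS addSn !factS !natrM.
  move: (fact0 (i + c)%N) (fact0 (i + m)%N) (nat0 (i + m)%N).
  move: (i + c)`!%:R (i + m)`!%:R (i + m).+1%:R (i + m + c)`!%:R i`!%:R (i + m + c).+1%:R.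
  by move=> r1 r2 r3 r4 r5 r6 r1_0 r2_0 r3_0; field; rewrite r1_0 r2_0 r3_0.
rewrite /PP; elim: a => [|a IH].
  rewrite big_geq // !add0n {1}/superfact big_ord0 mul1r [X in X / _]mulrAC divff //.
  by rewrite !mulf_neq0 ?superfact_neq0.
rewrite big_nat_recr //= IH boxj !addSn !superfactS.
move: (fact0 (a + c)%N) (fact0 (a + b)%N) (superfact_neq0 (a + b)) (superfact_neq0 (b + c))
  (superfact_neq0 (a + c)).
move: (a + c)`!%:R (a + b)`!%:R (a + b + c)`!%:R a`!%:R (superfact (a + b)) (superfact (b + c))
  (superfact (a + c)) (superfact (a + b + c)) (superfact a) (superfact b) (superfact c).
move=> r1 r2 r3 r4 r5 r6 r7 r8 r9 r10 r11 r1_0 r2_0 r5_0 r6_0 r7_0; field.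
by rewrite r1_0 r2_0 r5_0 r6_0 r7_0.
Qed.

Section Differences.
Variable W : nat.
Implicit Types (S U D V B : {set 'I_W}).

Definition set_diff_prod S : rat :=
  \prod_(i in S) \prod_(j in S | (i < j)%N) (j%:R - i%:R).

Definition cross_prod U V : rat :=
  \prod_(i in U) \prod_(j in V) `|j%:R - i%:R|.

Lemma increasing_lt r (s : 'I_r -> 'I_W) :
    (forall i j : 'I_r, (i < j)%N -> (s i < s j)%N) ->
  forall i j, (s i < s j)%N = (i < j)%N.
Proof.
move=> s_incr i j.
apply/idP/idP => [|/s_incr //]; have [//|ji|/ord_inj->] := ltngtP i j; last by rewrite ltnn.
by move=> /ltn_trans /(_ (s_incr _ _ ji)); rewrite ltnn.
Qed.

Lemma increasing_inj r (s : 'I_r -> 'I_W) :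
    (forall i j : 'I_r, (i < j)%N -> (s i < s j)%N) -> injective s.
Proof.
move=> /increasing_lt s_lt i j eq_s.
by have [||/ord_inj//] := ltngtP i j; rewrite -s_lt eq_s ltnn.
Qed.

Lemma diff_prod_image r (s : 'I_r -> 'I_W) :
    (forall i j : 'I_r, (i < j)%N -> (s i < s j)%N) ->
  diff_prod s = set_diff_prod [set s i | i : 'I_r] / superfact r.
Proof.
move=> s_incr.
have s_lt := increasing_lt s_incr; have s_inj := increasing_inj s_incr.
rewrite /diff_prod /set_diff_prod big_imset /=; last by move=> ? ? _ _; apply: s_inj.
rewrite -prod_diff_ord -prodf_div; apply: eq_big => [i|i _]; first by rewrite inE.
rewrite prodf_div; congr (_ / _).
rewrite big_mkcondr big_imset /=; last by move=> ? ? _ _; apply: s_inj.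
by rewrite -big_mkcondr; apply: eq_bigl => j; rewrite inE s_lt.
Qed.

Lemma patterns_positions h S : #|S| = h ->
  (patterns h (positions S))%:R = set_diff_prod S / superfact h.
Proof.
move=> <-; pose s (i : 'I_#|S|) : 'I_W := enum_val i.
have s_incr (i j : 'I_#|S|) : (i < j)%N -> (s i < s j)%N.
  move=> ij; have pS := positions_sorted S.
  have nthE (k : 'I_#|S|) : val (s k) = nth 0%N (positions S) k.
    by rewrite [s k](enum_val_nth (s k)) /positions (nth_map (s k)) // -cardE.
  rewrite !nthE; apply: (sorted_ltn_nth ltn_trans) => //; by rewrite inE size_positions.
have -> : positions S = [seq val (s i) | i <- enum 'I_#|S|].
  apply: (@eq_from_nth _ 0%N) => [|k]; first by rewrite size_positions size_map size_enum_ord.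
  rewrite size_positions => kS; pose k' := Ordinal kS.
  rewrite (nth_map k') ?size_enum_ord // (nth_ord_enum k' k').
  by rewrite [s k'](enum_val_nth (s k')) /positions (nth_map (s k')) // -cardE.
rewrite patterns_diff_prod // diff_prod_image //; congr (set_diff_prod _ / _).
apply/setP => i; apply/imsetP/idP => [[j _ ->]|iS]; first exact: enum_valP.
by exists (enum_rank_in iS i); rewrite // /s enum_rankK_in.
Qed.

Lemma prod_setU (F : 'I_W -> rat) U V : [disjoint U & V] ->
  \prod_(i in U :|: V) F i = \prod_(i in U) F i * \prod_(i in V) F i.
Proof.
by move=> dUV; rewrite -bigU //; apply: eq_bigl => i; rewrite !inE.
Qed.

(** Each pair formed of a point of U and a point of V is counted once in the whole
    difference product, in increasing order, that is with its distance. *)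
Lemma set_diff_prodU U V : [disjoint U & V] ->
  set_diff_prod (U :|: V) = set_diff_prod U * set_diff_prod V * cross_prod U V.
Proof.
move=> dUV; rewrite /set_diff_prod prod_setU //.
have inner (i : 'I_W) : \prod_(j in U :|: V | (i < j)%N) (j%:R - i%:R) =
    (\prod_(j in U | (i < j)%N) (j%:R - i%:R)) * \prod_(j in V | (i < j)%N) (j%:R - i%:R) :> rat.
  by rewrite big_mkcondr prod_setU // -!big_mkcondr.
rewrite !(eq_bigr _ (fun i _ => inner i)) !big_split /=.
have cross : (\prod_(i in U) \prod_(j in V | (i < j)%N) (j%:R - i%:R)) *
    (\prod_(i in V) \prod_(j in U | (i < j)%N) (j%:R - i%:R)) = cross_prod U V.
  rewrite [X in _ * X](exchange_big_dep (mem U)) /=; last by move=> i j _ /andP[].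
  rewrite -big_split; apply: eq_bigr => i iU.
  rewrite /= [RHS](bigID (fun j : 'I_W => (i < j)%N)) /=; congr (_ * _).
    by apply: eq_bigr => j /andP[_ ij]; rewrite ger0_norm // subr_ge0 ler_nat ltnW.
  apply: eq_big => j; rewrite iU /=.
    apply: andb_id2l => jV; rewrite -leqNgt [RHS]leq_eqVlt; case: eqP => // ji.
    by have := disjointFr dUV iU; rewrite -(ord_inj ji) jV.
  by move=> /andP[_ ji]; rewrite ler0_norm ?opprB // subr_le0 ler_nat ltnW.
rewrite -cross; ring.
Qed.

(** A point of both U and D occurs in both factors on the left, and once in each
    factor on the right. *)
Lemma cross_prod_UI U D V :
  cross_prod U V * cross_prod D V = cross_prod (U :|: D) V * cross_prod (U :&: D) V.
Proof.
rewrite /cross_prod.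
have -> : U :|: D = U :|: (D :\: U) by apply/setP => i; rewrite !inE; case: (i \in U).
rewrite prod_setU; last by rewrite -setI_eq0; apply/eqP/setP => i; rewrite !inE; case: (i \in U).
by rewrite -mulrA; congr (_ * _); rewrite (big_setID U) /= mulrC setIC.
Qed.

Lemma set_diff_prod_gt0 S : 0 < set_diff_prod S.
Proof. by apply: prodr_gt0 => i _; apply: prodr_gt0 => j /andP[_ ij]; rewrite subr_gt0 ltr_nat. Qed.

Lemma cross_prod_gt0 U V : [disjoint U & V] -> 0 < cross_prod U V.
Proof.
move=> dUV; apply: prodr_gt0 => i iU; apply: prodr_gt0 => j jV.
rewrite normr_gt0 subr_eq0 eqr_nat; apply: contraTneq jV => /ord_inj->.
by rewrite (disjointFr dUV).
Qed.

End Differences.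

(** * The shuffling theorem *)

Section Shuffling.
Variables x y n : nat.
Implicit Types S U D V B C I : {set 'I_(x + y + n)%N}.

(** The factor of M(H) that survives exchanging U and D for U' and D'; C stands for
    the union and I for the intersection of the two sets of dents. *)
Definition vertical_sum C I B : rat :=
  \sum_(V : {set 'I_(x + y + n)%N} | (#|V| == y) && [disjoint V & C :|: B])
     set_diff_prod V ^+ 2 * (cross_prod C V * cross_prod I V).

(** All terms are positive, and there is one, as at least x + y - x = y positions lie
    outside U, D and B. *)
Lemma vertical_sum_neq0 U D B :
    #|U :|: D| = n -> (#|B| <= x)%N ->
  vertical_sum (U :|: D) (U :&: D) B != 0.
Proof.
move=> cn bx; set C := U :|: D.
have term_gt0 V : [disjoint V & C :|: B] ->
   0 < set_diff_prod V ^+ 2 * (cross_prod C V * cross_prod (U :&: D) V).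
  move=> dV; have dCV : [disjoint C & V].
    by rewrite disjoint_sym; apply: disjointWr dV; apply: subsetUl.
  rewrite mulr_gt0 ?exprn_gt0 ?set_diff_prod_gt0 // mulr_gt0 ?cross_prod_gt0 //.
  by apply: disjointWl dCV; apply: subset_trans (subsetIl _ _) (subsetUl _ _).
have [V VCB Vy] : exists2 V : {set 'I_(x + y + n)%N}, V \subset ~: (C :|: B) & #|V| = y.
  set A := ~: (C :|: B); have yA : (y <= #|A|)%N.
    by rewrite cardsCs setCK card_ord; have := (leq_card_setU C B).1; rewrite cn; lia.
  exists [set i in take y (enum A)].
    by apply/subsetP => i; rewrite inE => /mem_take; rewrite mem_enum.
  rewrite cardsE (card_uniqP _) ?take_uniq ?enum_uniq // size_take_min -cardE.
  exact/minn_idPl.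
rewrite lt0r_neq0 // /vertical_sum (bigD1 V) /=; last first.
  by rewrite Vy eqxx disjoints_subset.
apply: ltr_wpDr; first by apply: sumr_ge0 => V' /andP[/andP[_ dV'] _]; apply/ltW/term_gt0.
by apply: term_gt0; rewrite disjoints_subset.
Qed.

Lemma M_H_product U D B : (#|U| <= n)%N -> (#|D| <= n)%N ->
  (M_H U D B)%:R =
    set_diff_prod U * set_diff_prod D / (superfact (y + #|U|) * superfact (y + #|D|)) *
    vertical_sum (U :|: D) (U :&: D) B.
Proof.
move=> Un Dn; rewrite M_H_sum // natr_sum mulr_sumr; apply: eq_bigr => V /andP[/eqP Vy dV].
have disj S : S \subset U :|: D -> [disjoint S & V].
  move=> sS; rewrite disjoint_sym; apply: disjointWr dV.
  exact: subset_trans sS (subsetUl _ _).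
have dUV := disj U (subsetUl _ _); have dDV := disj D (subsetUr _ _).
have card S : [disjoint S & V] -> #|S :|: V| = (y + #|S|)%N.
  by move=> dSV; rewrite cardsU (disjoint_setI0 dSV) cards0 subn0 Vy addnC.
rewrite natrM !patterns_positions ?card // !set_diff_prodU // -cross_prod_UI.
by field; rewrite !superfact_neq0.
Qed.
End Shuffling.

Theorem theorem2p3 (x y n u d u' d' : nat)
    (U D U' D' B : {set 'I_(x + y + n)%N})
    (s : 'I_u -> 'I_(x + y + n)%N) (t : 'I_d -> 'I_(x + y + n)%N)
    (s' : 'I_u' -> 'I_(x + y + n)%N) (t' : 'I_d' -> 'I_(x + y + n)%N)
    (s_incr : forall i j : 'I_u, (i < j)%N -> (s i < s j)%N)
    (t_incr : forall i j : 'I_d, (i < j)%N -> (t i < t j)%N)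
    (s'_incr : forall i j : 'I_u', (i < j)%N -> (s' i < s' j)%N)
    (t'_incr : forall i j : 'I_d', (i < j)%N -> (t' i < t' j)%N)
    (U_def : U = [set s i | i : 'I_u]) (D_def : D = [set t i | i : 'I_d])
    (U'_def : U' = [set s' i | i : 'I_u'])
    (D'_def : D' = [set t' i | i : 'I_d'])
    (le_u_n : (u <= n)%N) (le_d_n : (d <= n)%N)
    (card_UD : #|U :|: D| = n)
    (eq_cup : U :|: D = U' :|: D') (eq_cap : U :&: D = U' :&: D')
    (B_disj : B :&: (U :|: D) = set0) (card_B : (#|B| <= x)%N) :
  (M_H U D B)%:R / (M_H U' D' B)%:R =
  (diff_prod s * diff_prod t * PP u d y) /
  (diff_prod s' * diff_prod t' * PP u' d' y) :> rat.
Proof.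
have card_im r (f : 'I_r -> 'I_(x + y + n)%N) :
    (forall i j : 'I_r, (i < j)%N -> (f i < f j)%N) -> #|[set f i | i : 'I_r]| = r.
  by move=> /increasing_inj f_inj; rewrite card_imset // card_ord.
have Uu : #|U| = u by rewrite U_def card_im.
have Dd : #|D| = d by rewrite D_def card_im.
have U'u' : #|U'| = u' by rewrite U'_def card_im.
have D'd' : #|D'| = d' by rewrite D'_def card_im.
have card_sub (S : {set 'I_(x + y + n)%N}) : S \subset U :|: D -> (#|S| <= n)%N.
  by move=> /subset_leq_card; rewrite card_UD.
have udE : (u + d = u' + d')%N.
  by rewrite -Uu -Dd -U'u' -D'd' -cardsUI eq_cup eq_cap cardsUI.
have Z0 := vertical_sum_neq0 card_UD card_B.
rewrite !M_H_product ?Uu ?Dd //; try by apply: card_sub; rewrite eq_cup ?subsetUl ?subsetUr.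
rewrite -eq_cup -eq_cap U'u' D'd'.
move: (vertical_sum _ _ _) Z0 => Z Z0.
rewrite -mulf_div divff // mulr1.
(* the part of the right-hand side that depends on u and d only through u + d *)
pose K := superfact y * superfact (u + d + y) / superfact (u + d).
have K0 : K != 0 by rewrite !mulf_neq0 ?invr_eq0 ?superfact_neq0.
have side v e (f : 'I_v -> 'I_(x + y + n)%N) (g : 'I_e -> 'I_(x + y + n)%N) :
    (forall i j : 'I_v, (i < j)%N -> (f i < f j)%N) ->
    (forall i j : 'I_e, (i < j)%N -> (g i < g j)%N) -> (v + e = u + d)%N ->
  diff_prod f * diff_prod g * PP v e y =
    set_diff_prod [set f i | i : 'I_v] * set_diff_prod [set g i | i : 'I_e] /
    (superfact (y + v) * superfact (y + e)) * K.
  move=> f_incr g_incr veE; rewrite !diff_prod_image // PP_superfact /K -veE.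
  rewrite (addnC y v) (addnC y e).
  move: (superfact_neq0 v) (superfact_neq0 e) (superfact_neq0 (v + e))
    (superfact_neq0 (v + y)) (superfact_neq0 (e + y)).
  move: (superfact v) (superfact e) (superfact (v + e)) (superfact (v + y)) (superfact (e + y))
    (superfact y) (superfact (v + e + y)) (set_diff_prod _) (set_diff_prod _).
  move=> r1 r2 r3 r4 r5 r6 r7 r8 r9 r1_0 r2_0 r3_0 r4_0 r5_0; field.
  by rewrite r1_0 r2_0 r3_0 r4_0 r5_0.
rewrite !side // -!U_def -?D_def -?U'_def -?D'_def.
by rewrite -[in RHS]mulf_div divff // mulr1.
Qed.
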